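(* Let $(E_a)_{a\ge0}$ and $(F_a)_{a\ge0}$ be two decreasing families of Banach spaces with smoothing operators, as described in the context. Let $a_1,a_2,\alpha,\beta,a_0,\mu$ be real numbers with $$0\le a_0\le\mu\le a_1,\qquad a_1+\frac\beta2\le\alpha<a_1+\beta\le a_2,\qquad 2\alpha<a_1+a_2.$$ Let $V$ be a convex neighborhood of $0$ in $E_\mu$. Let $\Phi$ be a map from $V$ to $F_0$ such that $\Phi:V\cap E_{a+\mu}\to F_a$ is of class $C^2$ for all $a\in[0,a_2-\mu]$, with $$\|\Phi''(u)[v,w]\|_a\le C\big(\|v\|_{a+\mu}\|w\|_{a_0}+\|v\|_{a_0}\|w\|_{a+\mu}+\|u\|_{a+\mu}\|v\|_{a_0}\|w\|_{a_0}\big)$$ for all $u\in V\cap E_{a+\mu}$, $v,w\in E_{a+\mu}$. Also assume that $\Phi'(v)$, for $v\in E_\infty\cap V$ belonging to some ball $\|v\|_{a_1}\le\delta_1$ (where $\delta_1>0$), has a right inverse $\Psi(v)$ mapping $F_\infty$ to $E_{a_2}$, and that $$\|\Psi(v)g\|_a\le C\big(\|g\|_{a+\beta-\alpha}+\|g\|_0\|v\|_{a+\beta}\big)\qquad\forall a\in[a_1,a_2]$$ (for all such $v$ and all $g\in F_\infty$). Then there exist $\delta>0$ and a constant $C$ such that, for every $g\in F'_\beta$ in the ball $\|g\|'_\beta\le\delta$, there exists $u\in E'_\alpha$, with $\|u\|'_\alpha\le C\|g\|'_\beta$, solving $\Phi(u)=\Phi(0)+g$.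
   Context: Scales with smoothing operators: $E_a$, $a\ge0$, is a decreasing family of Banach spaces with injections $E_b\hookrightarrow E_a$ of norm $\le1$ when $b\ge a$; $\|\cdot\|_a$ is the norm of $E_a$; $E_\infty=\bigcap_{a\ge0}E_a$ with the weakest topology making the injections $E_\infty\hookrightarrow E_a$ continuous. There are linear operators $S_\theta:E_0\to E_\infty$, $\theta\ge1$, such that, with constants $C$ bounded when $a,b$ are bounded, $\|S_\theta u\|_b\le C\|u\|_a$ if $b\le a$; $\|S_\theta u\|_b\le C\theta^{b-a}\|u\|_a$ if $a<b$; $\|u-S_\theta u\|_b\le C\theta^{b-a}\|u\|_a$ if $a>b$; $\|\frac{d}{d\theta}S_\theta u\|_b\le C\theta^{b-a-1}\|u\|_a$ (for all $a,b$). The family $(F_a)_{a\ge0}$ has the same properties with its own smoothing operators; its norms are also denoted $\|\cdot\|_a$. No compactness of the embeddings $F_b\hookrightarrow F_a$ is assumed. Weak spaces: fix a sequence $1=\theta_0<\theta_1<\dots\to\infty$ with $\theta_{j+1}/\theta_j$ bounded and set $\Delta_j:=\theta_{j+1}-\theta_j$. For $a>0$, fix auxiliary numbers $0\le b_1<a<b_2$. $E'_a$ is the set of all sums $u=\sum_{j\ge0}\Delta_ju_j$ (which converge in $E_b$ for every $b<a$) with $u_j\in E_{b_2}$ such that, for some $M$, $\|u_j\|_b\le M\theta_j^{b-a-1}$ for $b=b_1$ and for $b=b_2$ and all $j$; $\|u\|'_a$ is the infimum of $M$ over all such decompositions. (The space $E'_a$ and, up to equivalence, its norm do not depend on the choice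 of $b_1,b_2$ nor on the smoothing operators.) $F'_a$ is defined in the same way from the family $(F_a)$. *)

(* Defs.v *)
From HB Require Import structures.
From mathcomp Require Import all_boot all_order all_algebra.
From mathcomp Require Import all_classical all_reals all_analysis.

Set Implicit Arguments.
Unset Strict Implicit.
Unset Printing Implicit Defensive.

Import Order.TTheory GRing.Theory Num.Theory.
Import numFieldNormedType.Exports.
Local Open Scope classical_set_scope.
Local Open Scope ring_scope.

(* A decreasing family of Banach spaces.  Only indices a >= 0 are meaningful
   (the spaces and maps attached to negative indices are unconstrained), and
   [emb a b] is the injection E_b -> E_a when 0 <= a <= b. *)
Record banach_scale (R : realType) := BanachScale {
  scale_space :> R -> completeNormedModType R;
  emb : forall a b : R, {linear scale_space b -> scale_space a};
  emb_injective : forall a b : R, 0 <= a -> a <= b -> injective (emb a b);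
  emb_norm_le : forall a b : R, 0 <= a -> a <= b ->
    forall u : scale_space b, `|emb a b u| <= `|u|;
  emb_refl : forall a : R, 0 <= a -> forall u : scale_space a, emb a a u = u;
  emb_trans : forall a b c : R, 0 <= a -> a <= b -> b <= c ->
    forall u : scale_space c, emb a b (emb b c u) = emb a c u }.

Arguments emb {R} E a b : rename.

Section Scales.
Context {R : realType}.
Implicit Types (E F : banach_scale R) (a b : R).

(* E_a as a subset of E_0. *)
Definition in_space E a : set (E 0) := range (emb E 0 a).

(* The norm of E_a read on E_0: the preimage under the injection is unique when
   it exists, and the value is 0 (without meaning) outside E_a. *)
Definition space_norm E a (u : E 0) : R :=
  `| xget (0 : E a) [set x : E a | emb E 0 a x = u] |.

Definition in_infty E : set (E 0) :=
  [set u | forall a, 0 <= a -> in_space a u].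

(* [smoothing E S]: the S_theta, theta >= 1, are smoothing operators for E.
   [dS theta u] is the derivative of theta |-> S_theta u for the topology of
   E_infty, i.e. in every E_b; it is one-sided at theta = 1.  "Constants bounded
   when a, b are bounded" means one constant for all a, b in [0, N]. *)
Definition smoothing E (S : R -> E 0 -> E 0) : Prop :=
  [/\ forall theta, 1 <= theta -> linear (S theta),
      forall theta u, 1 <= theta -> in_infty (S theta u) &
  exists dS : R -> E 0 -> E 0,
  [/\ forall theta u, 1 <= theta -> in_infty (dS theta u),
      forall theta u b, 1 <= theta -> 0 <= b ->
        space_norm b (h^-1 *: (S (theta + h) u - S theta u) - dS theta u)
          @[h --> within [set h | 1 <= theta + h] (0 : R)^'] --> (0 : R) &
      forall N : R, exists C : R, forall a b theta (u : E 0),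
        0 <= a <= N -> 0 <= b <= N -> 1 <= theta -> in_space a u ->
        [/\ b <= a -> space_norm b (S theta u) <= C * space_norm a u,
            a < b -> space_norm b (S theta u)
                       <= C * theta `^ (b - a) * space_norm a u,
            b < a -> space_norm b (u - S theta u)
                       <= C * theta `^ (b - a) * space_norm a u &
            space_norm b (dS theta u)
              <= C * theta `^ (b - a - 1) * space_norm a u]]].

Definition admissible_seq (theta : nat -> R) : Prop :=
  [/\ theta 0%N = 1, forall j, theta j < theta j.+1,
      theta @ \oo --> +oo &
      exists K : R, forall j, theta j.+1 / theta j <= K].

(* [weak_decomp theta b1 a u x M] (b2 is implicit): u is the sum of the Delta_j x_j, in E_b for
   every b < a, with x_j in E_{b2} satisfying the two bounds with constant M.
   Meaningful for 0 <= b1 < a < b2. *)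
Definition weak_decomp E (theta : nat -> R) (b1 b2 a : R) (u : E 0)
    (x : nat -> E b2) (M : R) : Prop :=
  (forall b, 0 <= b -> b < a -> exists2 y : E b, emb E 0 b y = u &
     series (fun j => (theta j.+1 - theta j) *: emb E b b2 (x j)) @ \oo --> y)
  /\ (forall j, `|emb E b1 b2 (x j)| <= M * theta j `^ (b1 - a - 1)
             /\ `|x j| <= M * theta j `^ (b2 - a - 1)).

Definition weak_space E (theta : nat -> R) (b1 b2 a : R) : set (E 0) :=
  [set u | exists (x : nat -> E b2) (M : R), weak_decomp theta b1 a u x M].

Definition weak_norm E (theta : nat -> R) (b1 b2 a : R) (u : E 0) : R :=
  inf [set M : R | exists x : nat -> E b2, weak_decomp theta b1 a u x M].

(* f is of class C^2 on A with first and second derivatives df, d2f.  A need not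
   be open: difference quotients are taken within A (on a convex set with
   nonempty interior the derivatives are still unique), which is the usual
   Frechet notion when A is open.  Spaces of (bi)linear maps carry the operator
   norm, and d2f u h w = (f''(u) h) w.  Continuity of f and f' is automatic. *)
Definition C2_on (U W : normedModType R) (A : set U) (f : U -> W)
    (df : U -> {linear U -> W}) (d2f : U -> {bilinear U -> U -> W}) : Prop :=
  forall u, A u ->
  [/\ continuous (df u),
      continuous (fun p : U * U => d2f u p.1 p.2),
      forall e : R, 0 < e -> \forall x \near within A (nbhs u),
        `|f x - f u - df u (x - u)| <= e * `|x - u|,
      forall e : R, 0 < e -> \forall x \near within A (nbhs u), forall w : U,
        `|df x w - df u w - d2f u (x - u) w| <= e * `|x - u| * `|w| &
      forall e : R, 0 < e -> \forall x \near within A (nbhs u), forall v w : U,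
        `|d2f x v w - d2f u v w| <= e * `|v| * `|w|].

(* Phi maps V `&` E_c into F_a and is of class C^2 as a map V `&` E_c -> F_a
   (here mu <= c), with derivatives dPhi, d2Phi.  The derivatives at different
   levels (c, a) are restrictions of one another, by uniqueness of derivatives,
   so the same dPhi and d2Phi serve for all levels. *)
Definition C2_level E F (mu : R) (V : set (E mu)) (Phi : E mu -> F 0)
    (dPhi : E mu -> E mu -> F 0) (d2Phi : E mu -> E mu -> E mu -> F 0)
    (c a : R) : Prop :=
  let i := emb E mu c in let k := emb F 0 a in
  exists (f : E c -> F a) (df : E c -> {linear E c -> F a})
         (d2f : E c -> {bilinear E c -> E c -> F a}),
    C2_on (i @^-1` V) f df d2f /\
    forall u : E c, V (i u) ->
      [/\ k (f u) = Phi (i u),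
          forall v, k (df u v) = dPhi (i u) (i v) &
          forall v w, k (d2f u v w) = d2Phi (i u) (i v) (i w)].

End Scales.

(* Main.v *)
Require Import Defs.
From HB Require Import structures.
From mathcomp Require Import all_boot all_order all_algebra.
From mathcomp Require Import all_classical all_reals all_analysis.
From mathcomp Require Import ring lra.
Set Implicit Arguments.
Unset Strict Implicit.
Unset Printing Implicit Defensive.
Import Order.TTheory GRing.Theory Num.Theory.
Import numFieldNormedType.Exports.
Local Open Scope classical_set_scope.
Local Open Scope ring_scope.

(** The proof is the Newton scheme with smoothing of Nash, Moser and Hormander,
run along the dyadic sequence t_k = 2^k.  Write T_k for the smoothing operators
at t_k.  Starting from u_0 = 0, each step corrects u_k by

    h_k = Psi (v_k) gamma_k,  where v_k = T_k u_k and u_{k+1} = u_k + h_k,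

and the right-hand sides gamma_k are chosen so that their partial sums are
gamma_0 + ... + gamma_k = T_k (g - E_k), where E_k is the accumulated error
Phi u_k - Phi 0 - (gamma_0 + ... + gamma_{k-1}).  Then
Phi u_{k+1} - Phi 0 = T_k (g - E_k) + E_{k+1}, which tends to g once E_k - T_k E_k
and E_{k+1} - E_k tend to 0 in F_0 ([Phi_un_cvg]).

Everything rests on one invariant ([step_bound]): |h_k|_a <= kappa t_k^(a - alpha)
for all a in [a1, a2], where kappa is a multiple of the size eps of g.  It gives
|u_k - v_k|_a <= C kappa t_k^(a - alpha) for a = a1 and a = a2, hence, by Taylor's
formula and the tame bound on the second derivative of Phi
([level_newton_error]), the quadratic estimate
|E_{k+1} - E_k|_b <= C kappa^2 t_k^(b - beta) for b = 0 and for b = a2 - mu.  The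
exponents match because 2 (alpha - a1) >= beta and mu <= a1.  Summing these two
bounds and smoothing yields |gamma_k|_b <= C (eps + kappa^2) t_k^(b - beta) for all
b in a bounded range ([gam_le]), and the bound on the right inverse turns this
into |h_k|_a <= C' (eps + kappa^2) t_k^(a - alpha).  Since the constants depend on
neither eps nor kappa, the choice kappa = 2 C' eps with eps small closes the induction
([hn_le]).  Convergence in the intermediate spaces then comes from their
completeness.

The bounds on h_k say that the sum u of the h_k lies in the weak space of
exponent alpha, for the dyadic sequence and the pair (a1, a2).  The given
sequence theta and the exponents (b1, b2), (c1, c2) are arbitrary, and the ratio
of consecutive increments of theta is not controlled, so that theta itself does
not suit the iteration: one term of gamma_k comes from step k - 1.  Both
g and u are therefore transferred between sequences.  This is possible because, for
u = sum Delta_j u_j in a weak space, comparing the two bounds on u_j on either side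
of the index where theta_j passes s gives
|S_s' u - S_s u|_b <= C M (s' - s) s^(b - a - 1) for every b, whenever
s <= s' <= K s ([weak_operator_bound], [weak_smoothing_bounds]); the increments
of S_theta u along any other sequence then form a decomposition of u
([weak_change]). *)

(** * The mean value inequality *)

Section MeanValue.
Context {R : realType}.

(** The local Lipschitz form of the hypothesis covers a derivative taken within
the interval, for whatever norm controls the increments.  For slope M + e the set
of points reached from s with that slope is closed, and it can be prolonged
from any of its points, so that its supremum is t. *)
Lemma mean_value_le (W : normedModType R) (f : R -> W) (s t M : R) :
  s <= t ->
  (forall x, s <= x <= t -> forall e : R, 0 < e ->
     exists2 d : R, 0 < d & forall y, s <= y <= t -> `|y - x| < d ->
       `|f y - f x| <= (M + e) * `|y - x|) ->
  `|f t - f s| <= M * (t - s).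
Proof.
move=> st H.
suff main e : 0 < e -> `|f t - f s| <= (M + e) * (t - s).
  apply/ler_addgt0Pr => e e0.
  have d0 : 0 < t - s + 1 by rewrite ltr_wpDl // subr_ge0.
  have := main (e / (t - s + 1)) (divr_gt0 e0 d0).
  move=> /le_trans; apply; rewrite mulrDl lerD2l -mulrA ger_pMr //.
  by rewrite mulrC ler_pdivrMr // mul1r lerDl.
move=> e0.
pose A := [set x | s <= x <= t /\ `|f x - f s| <= (M + e) * (x - s)].
have As : A s by split; rewrite ?lexx ?st// !subrr normr0 mulr0.
have ubA : ubound A t by move=> x [/andP[]].
have hA : has_sup A by split; [exists s | exists t].
pose c := sup A.
have sc : s <= c by apply: ub_le_sup => //; exists t.
have ct : c <= t by apply: ge_sup => //; exists s.
have cst : s <= c <= t by rewrite sc ct.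
have [d d0 Hd] := H c cst _ e0.
have Ac : A c.
  have [x Ax cx] := sup_adherent d0 hA.
  have xc : x <= c by apply: ub_le_sup => //; exists t.
  case: (Ax) => xst Hx.
  split=> //.
  rewrite -(subrKA (f x)); apply: (le_trans (ler_normD _ _)).
  have dx : `|x - c| < d by rewrite ler0_norm ?subr_le0// opprB ltrBlDr -ltrBlDl.
  have := Hd _ xst dx; rewrite distrC (distrC x) (ger0_norm (x := c - x)) ?subr_ge0// => h2.
  by apply: (le_trans (lerD h2 Hx)); rewrite -mulrDr subrKA.
case: (ltP c t) => [ct'|tc]; last first.
  have ->: t = c by apply/le_anti/andP.
  by case: Ac.
(* a point to the right of c, still within reach of the local bound at c *)
pose y := Num.min t (c + d / 2).
have cy : c < y by rewrite lt_min ct'/= ltrDl divr_gt0.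
have yst : s <= y <= t by rewrite (le_trans sc (ltW cy))/= ge_min lexx.
have dy : `|y - c| < d.
  rewrite gtr0_norm ?subr_gt0// ltrBlDl (@le_lt_trans _ _ (c + d/2))//.
    by rewrite ge_min lexx orbT.
  by rewrite ltrD2l ltr_pdivrMr// ltr_pMr// ltr1n.
have := Hd _ yst dy; rewrite (gtr0_norm (x := y - c)) ?subr_gt0// => h2.
suff Ay : A y.
  have : y <= c by apply: ub_le_sup => //; exists t.
  by rewrite leNgt cy.
split=> //; case: Ac => _ h1.
rewrite -(subrKA (f c)); apply: (le_trans (ler_normD _ _)).
by apply: (le_trans (lerD h2 h1)); rewrite -mulrDr subrKA.
Qed.

End MeanValue.

(** * Norms of a scale, read on its largest space *)

Section ScaleCalculus.
Context {R : realType}.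
Implicit Types (E : banach_scale R) (a b c : R).

(** The element of E_a represented by a vector of E_0; the default 0 is only
met outside E_a. *)
Definition lift E a (u : E 0) : E a := xget 0 [set x : E a | emb E 0 a x = u].

Lemma lift_emb E a (x : E a) : 0 <= a -> lift a (emb E 0 a x) = x.
Proof.
move=> a0; apply: (emb_injective (b0 := E) (lexx 0) a0).
by rewrite /lift; case: xgetP => [y _ /= ->//|H]; case: (H x).
Qed.

Lemma emb_lift E a (u : E 0) : in_space a u -> emb E 0 a (lift a u) = u.
Proof.
move=> [x _ xu]; rewrite /lift.
by case: xgetP => [y _ /= ->//|H]; case: (H x).
Qed.

Lemma space_normE E a (x : E a) : 0 <= a -> space_norm a (emb E 0 a x) = `|x|.
Proof. by move=> a0; rewrite /space_norm -/(lift a _) lift_emb. Qed.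

Lemma norm_lift E a (u : E 0) : `|lift a u| = space_norm a u.
Proof. by []. Qed.

Lemma emb0 E (u : E 0) : emb E 0 0 u = u.
Proof. exact: emb_refl. Qed.

Lemma space_norm0 E (u : E 0) : space_norm 0 u = `|u|.
Proof. by rewrite -{1}(emb0 u) space_normE. Qed.

Lemma in_space_emb E a (x : E a) : in_space a (emb E 0 a x).
Proof. by exists x. Qed.

Lemma in_space_zero E a : in_space a (0 : E 0).
Proof. by exists 0 => //; rewrite linear0. Qed.

Lemma in_spaceD E a (u v : E 0) : in_space a u -> in_space a v -> in_space a (u + v).
Proof. by move=> [x _ <-] [y _ <-]; exists (x + y) => //; rewrite linearD. Qed.

Lemma in_spaceB E a (u v : E 0) : in_space a u -> in_space a v -> in_space a (u - v).
Proof. by move=> [x _ <-] [y _ <-]; exists (x - y) => //; rewrite linearB. Qed.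

Lemma in_spaceZ E a (k : R) (u : E 0) : in_space a u -> in_space a (k *: u).
Proof. by move=> [x _ <-]; exists (k *: x) => //; rewrite linearZ. Qed.

Lemma in_space_sum E a (u : nat -> E 0) n : (forall i, (i < n)%N -> in_space a (u i)) ->
  in_space a (\sum_(0 <= i < n) u i).
Proof.
elim: n => [|n IH] H; first by rewrite big_nil; exact: in_space_zero.
rewrite big_nat_recr//=; apply: in_spaceD; last exact: H.
by apply: IH => i ni; apply: H; rewrite ltnS ltnW.
Qed.

Lemma in_space_mono E a b (u : E 0) : 0 <= a -> a <= b -> in_space b u -> in_space a u.
Proof. by move=> a0 ab [x _ <-]; exists (emb E a b x) => //; rewrite emb_trans. Qed.

Lemma space_norm_ge0 E a (u : E 0) : 0 <= space_norm a u.
Proof. exact: normr_ge0. Qed.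

Lemma space_normD E a (u v : E 0) : 0 <= a -> in_space a u -> in_space a v ->
  space_norm a (u + v) <= space_norm a u + space_norm a v.
Proof.
move=> a0 [x _ <-] [y _ <-]; rewrite -linearD !space_normE//.
exact: ler_normD.
Qed.

Lemma space_normB E a (u v : E 0) : 0 <= a -> in_space a u -> in_space a v ->
  space_norm a (u - v) <= space_norm a u + space_norm a v.
Proof.
move=> a0 [x _ <-] [y _ <-]; rewrite -linearB !space_normE//.
exact: ler_normB.
Qed.

Lemma space_normZ E a (k : R) (u : E 0) : 0 <= a -> in_space a u ->
  space_norm a (k *: u) = `|k| * space_norm a u.
Proof. by move=> a0 [x _ <-]; rewrite -linearZ !space_normE// normrZ. Qed.

Lemma space_norm_zero E a : 0 <= a -> space_norm a (0 : E 0) = 0.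
Proof. by move=> a0; rewrite -(linear0 (emb E 0 a)) space_normE// normr0. Qed.

Lemma space_norm_sum E a (u : nat -> E 0) n : 0 <= a ->
  (forall i, (i < n)%N -> in_space a (u i)) ->
  space_norm a (\sum_(0 <= i < n) u i) <= \sum_(0 <= i < n) space_norm a (u i).
Proof.
move=> a0; elim: n => [|n IH] H; first by rewrite !big_nil space_norm_zero.
have H' i : (i < n)%N -> in_space a (u i).
  by move=> ni; apply: H; rewrite ltnS ltnW.
rewrite !big_nat_recr//=.
apply: (le_trans (space_normD a0 (in_space_sum H') (H _ _))) => //.
by rewrite lerD2r; apply: IH.
Qed.

Lemma space_norm_mono E a b (u : E 0) : 0 <= a -> a <= b -> in_space b u ->
  space_norm a u <= space_norm b u.
Proof.
move=> a0 ab [x _ <-]; rewrite -[in leLHS](emb_trans (b0 := E) (lexx 0) a0 ab).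
by rewrite !space_normE ?(le_trans a0)// emb_norm_le.
Qed.

Lemma norm_le_space_norm E a (u : E 0) : 0 <= a -> in_space a u ->
  `|u| <= space_norm a u.
Proof. by move=> a0 H; rewrite -(space_norm0 u); apply: space_norm_mono. Qed.

Lemma emb_cvg E a b (x : nat -> E b) (y : E b) : 0 <= a -> a <= b ->
  x @ \oo --> y -> (fun n => emb E a b (x n)) @ \oo --> emb E a b y.
Proof.
move=> a0 ab /cvgrPdist_le H; apply/cvgrPdist_le => e e0.
near=> n; rewrite -linearB; apply: (le_trans (emb_norm_le a0 ab _)).
by near: n; apply: H.
Unshelve. all: by end_near. Qed.

Lemma abs_cvg_series (W : completeNormedModType R) (x : nat -> W) (r : nat -> R) (B : R) :
  (forall i, `|x i| <= r i) -> (forall n, \sum_(0 <= i < n) r i <= B) -> cvgn (series x).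
Proof.
move=> xr rB; apply: normed_cvg; apply: nondecreasing_is_cvgn.
  by apply: nondecreasing_series => i _ _; exact: normr_ge0.
exists B => _ [n _ <-]; apply: le_trans (rB n).
by apply: ler_sum => i _; exact: xr.
Qed.

(** Membership of a limit in a smaller space of the scale is never assumed: it comes
from completeness of E_a, by absolute convergence, and injectivity into E_0
identifies the limit. *)
Lemma abs_cvg_in_space E a (x : nat -> E a) (r : nat -> R) (B : R) (u : E 0) :
  0 <= a -> (forall i, `|x i| <= r i) -> (forall n, \sum_(0 <= i < n) r i <= B) ->
  series (fun i => emb E 0 a (x i)) @ \oo --> u ->
  exists2 y : E a, emb E 0 a y = u & series x @ \oo --> y.
Proof.
move=> a0 xr rB xu; have xy := abs_cvg_series xr rB.
exists (limn (series x)) => //.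
apply: (cvg_unique _ _ xu); first exact: norm_hausdorff.
have -> : series (fun i => emb E 0 a (x i)) = fun n => emb E 0 a (series x n).
  by apply/funext => n; rewrite /series/= linear_sum.
by apply: emb_cvg.
Qed.

Lemma cvg_norm_le (W : normedModType R) (x : nat -> W) (y : W) (B : R) :
  x @ \oo --> y -> (forall n, `|x n| <= B) -> `|y| <= B.
Proof.
move=> /cvgrPdist_le xy xB; apply/ler_addgt0Pr => e e0.
have [n _ /(_ n (leqnn n)) yx] := xy e e0.
by rewrite -(subrK (x n) y) (le_trans (ler_normD _ _))// addrC lerD.
Qed.

End ScaleCalculus.

(** * Sums along an admissible sequence *)

Section Sums.
Context {R : realType}.

(** Uses r^t >= 1 + t ln r and ln r >= 1 - 1/r, so that no case distinction on
t < 1 is needed. *)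
Lemma sub1_le_powR (K r t : R) : 0 < t -> 1 <= r -> r <= K ->
  r - 1 <= K / t * (r `^ t - 1).
Proof.
move=> t0 r1 rK; have r0 : 0 < r by apply: lt_le_trans r1.
have K0 : 0 < K by apply: lt_le_trans rK.
have h1 : 1 + t * ln r <= r `^ t.
  by rewrite /powR gt_eqF//; exact: expR_ge1Dx.
have h2 : 1 - r^-1 <= ln r.
  have hr : -1 < r^-1 - 1 by rewrite ltrBrDr addNr invr_gt0.
  have := le_ln1Dx hr.
  have -> : 1 + (r^-1 - 1) = r^-1 by ring.
  by rewrite lnV ?posrE//; lra.
have h3 : (r - 1) / K <= 1 - r^-1.
  have -> : 1 - r^-1 = (r - 1) / r by rewrite mulrBl divff ?gt_eqF// mul1r.
  by rewrite ler_wpM2l ?subr_ge0// lef_pV2 ?posrE.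
have h4 : t * ((r - 1) / K) <= r `^ t - 1.
  apply: (@le_trans _ _ (t * ln r)); last by rewrite lerBrDl.
  apply: ler_wpM2l; [exact: ltW | exact: le_trans h2].
have Kt : 0 <= K / t by rewrite divr_ge0 ?ltW.
apply: le_trans (ler_wpM2l Kt h4).
rewrite le_eqVlt; apply/orP; left; apply/eqP; field.
by rewrite !gt_eqF.
Qed.

(** A term of a left Riemann sum of x^(t-1) is at most a constant times the
increment of the primitive, because consecutive points have bounded ratio; this
makes the sums below telescope. *)
Lemma gap_le_pos (K x y t : R) : 0 < t -> 0 < x -> x <= y -> y <= K * x ->
  (y - x) * x `^ (t - 1) <= K / t * (y `^ t - x `^ t).
Proof.
move=> t0 x0 xy yK; have y0 := lt_le_trans x0 xy.
have r1 : 1 <= y / x by rewrite ler_pdivlMr// mul1r.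
have rK : y / x <= K by rewrite ler_pdivrMr.
have := ler_wpM2l (powR_ge0 x t) (sub1_le_powR t0 r1 rK).
have -> : x `^ t * (y / x - 1) = (y - x) * x `^ (t - 1).
  rewrite powRD ?(gt_eqF x0) ?implybT// powR_inv1 ?ltW//; field.
  by rewrite gt_eqF.
move=> /le_trans; apply.
rewrite [X in X - x `^ t](_ : y `^ t = x `^ t * (y / x) `^ t); last first.
  rewrite -powRM ?divr_ge0 ?ltW//; congr (_ `^ _); field.
  by rewrite gt_eqF.
rewrite le_eqVlt; apply/orP; left; apply/eqP; ring.
Qed.

Lemma gap_le_neg (K x y t : R) : 0 < t -> 0 < x -> x <= y -> y <= K * x ->
  (y - x) * x `^ (- t - 1) <= K / t * K `^ t * (x `^ (- t) - y `^ (- t)).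
Proof.
move=> t0 x0 xy yK; have y0 := lt_le_trans x0 xy.
have r1 : 1 <= y / x by rewrite ler_pdivlMr// mul1r.
have rK : y / x <= K by rewrite ler_pdivrMr.
have K0 : 0 < K by apply: lt_le_trans rK; apply: lt_le_trans r1.
have := ler_wpM2l (powR_ge0 x (-t)) (sub1_le_powR t0 r1 rK).
have -> : x `^ (- t) * (y / x - 1) = (y - x) * x `^ (- t - 1).
  rewrite [in RHS]powRD ?(gt_eqF x0) ?implybT// powR_inv1 ?ltW//; field.
  by rewrite gt_eqF.
move=> /le_trans; apply.
have rt : (y / x) `^ t <= K `^ t by apply: (ge0_ler_powR (ltW t0) _ _ rK); rewrite nnegrE ?divr_ge0// ltW.
set z := (y / x) `^ t in rt *.
have z1 : 1 <= z by rewrite -(powRr0 (y / x)) ler_powR// ltW.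
have z0 : 0 < z by apply: lt_le_trans z1.
rewrite [X in _ <= _ * (_ - X)](_ : _ = x `^ (- t) * z^-1); last first.
  rewrite /z -powRN (_ : (y / x) `^ (- t) = y `^ (- t) * x `^ t).
    rewrite mulrCA -powRD ?addNr ?powRr0 ?mulr1//.
    by rewrite ?(gt_eqF x0) ?implybT.
  rewrite powRM ?invr_ge0 ?ltW//; congr (_ * _).
  rewrite -[X in X `^ (- t)]powR_inv1 ?ltW// -powRrM; congr (_ `^ _); ring.
have -> : x `^ (- t) - x `^ (- t) * z^-1 = x `^ (- t) * ((z - 1) / z).
  by rewrite mulrBl divff ?gt_eqF// mul1r mulrBr mulr1.
have h : z - 1 <= K `^ t * ((z - 1) / z).
  by rewrite mulrCA ler_peMr ?subr_ge0// ler_pdivlMr// mul1r.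
have -> : K / t * K `^ t * (x `^ (- t) * ((z - 1) / z)) =
  x `^ (- t) * (K / t * (K `^ t * ((z - 1) / z))) by ring.
by rewrite !ler_wpM2l ?powR_ge0 ?divr_ge0 ?(ltW K0) ?(ltW t0).
Qed.

Lemma admissible_ge1 (theta : nat -> R) : admissible_seq theta -> forall j, 1 <= theta j.
Proof.
move=> [t0 tS _ _]; elim=> [|j IH]; first by rewrite t0.
by rewrite (le_trans IH)// ltW.
Qed.

Lemma admissible_gt0 (theta : nat -> R) : admissible_seq theta -> forall j, 0 < theta j.
Proof. by move=> H j; apply: lt_le_trans (admissible_ge1 H j). Qed.

Lemma admissible_homo (theta : nat -> R) : admissible_seq theta ->
  forall i j, (i <= j)%N -> theta i <= theta j.
Proof.
move=> [t0 tS _ _] i j ij; rewrite -(subnKC ij).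
elim: (j - i)%N => [|n IH]; first by rewrite addn0.
by rewrite addnS (le_trans IH)// ltW.
Qed.

Lemma admissible_ratio (theta : nat -> R) : admissible_seq theta ->
  exists2 K, 1 <= K & forall j, theta j.+1 <= K * theta j.
Proof.
move=> H; have p := admissible_gt0 H; case: (H) => t0 tS _ [K HK].
exists K; last by move=> j; rewrite -ler_pdivrMr.
apply: le_trans (HK 0%N).
by rewrite ler_pdivlMr// mul1r ltW.
Qed.

(** Discrete version of the integral of x^(s-1) over [1, theta_j]. *)
Lemma sum_pos_le (theta : nat -> R) (s : R) : admissible_seq theta -> 0 < s ->
  exists2 C, 0 < C & forall j,
  \sum_(0 <= i < j) (theta i.+1 - theta i) * theta i `^ (s - 1) <= C * theta j `^ s.
Proof.
move=> H s0; have p := admissible_gt0 H; have [K K1 HK] := admissible_ratio H.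
have K0 : 0 < K by apply: lt_le_trans K1.
exists (K / s); first by rewrite divr_gt0.
move=> j; apply: (@le_trans _ _
  (\sum_(0 <= i < j) (K / s) * (theta i.+1 `^ s - theta i `^ s))).
  apply: ler_sum => i _; apply: gap_le_pos => //.
  by case: H => _ /(_ i) /ltW.
rewrite -mulr_sumr ler_wpM2l ?(ltW (divr_gt0 K0 s0))//.
by rewrite telescope_sumr// lerBlDr lerDl powR_ge0.
Qed.

(** Discrete version of the integral of x^(s-1) over [theta_j, oo).  It is stated
for all finite ends n, which is what absolute convergence requires. *)
Lemma sum_neg_le (theta : nat -> R) (s : R) : admissible_seq theta -> s < 0 ->
  exists2 C, 0 < C & forall j n,
  \sum_(j <= i < n) (theta i.+1 - theta i) * theta i `^ (s - 1) <= C * theta j `^ s.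
Proof.
move=> H s0; have p := admissible_gt0 H; have [K K1 HK] := admissible_ratio H.
have K0 : 0 < K by apply: lt_le_trans K1.
have t0 : 0 < - s by rewrite oppr_gt0.
exists (K / (- s) * K `^ (- s)); first by rewrite mulr_gt0 ?divr_gt0 ?powR_gt0.
move=> j n; have [jn|nj] := leqP j n; last first.
  by rewrite big_geq 1?ltnW// mulr_ge0 ?powR_ge0// mulr_ge0 ?powR_ge0 ?divr_ge0 ?ltW.
apply: (@le_trans _ _
  (\sum_(j <= i < n) (K / (- s) * K `^ (- s)) * (theta i `^ s - theta i.+1 `^ s))).
  apply: ler_sum => i _.
  have := @gap_le_neg K _ _ _ t0 (p i) _ (HK i); rewrite opprK; apply.
  by case: H => _ /(_ i) /ltW.
rewrite -mulr_sumr ler_wpM2l//.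
  by rewrite mulr_ge0 ?powR_ge0 ?divr_ge0 ?ltW.
rewrite -lerN2 -sumrN (eq_bigr (fun i => theta i.+1 `^ s - theta i `^ s)); last first.
  by move=> i _; rewrite opprB.
by rewrite telescope_sumr// lerBrDl subrr powR_ge0.
Qed.

Definition dyadic (k : nat) : R := 2 ^+ k.

Lemma dyadic_gap k : dyadic k.+1 - dyadic k = dyadic k.
Proof. by rewrite /dyadic exprS; ring. Qed.

Lemma dyadic_admissible : admissible_seq dyadic.
Proof.
have d0 j : 0 < dyadic j by rewrite exprn_gt0.
split.
- by rewrite /dyadic expr0.
- by move=> j; rewrite -subr_gt0 dyadic_gap.
- apply/cvgryPge => A; near=> n.
  apply: (@le_trans _ _ n%:R); first by near: n; exact: nbhs_infty_ger.
  by rewrite /dyadic -natrX ler_nat ltnW// ltn_expl.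
- by exists 2 => j; rewrite /dyadic exprS -mulrA divff ?mulr1// gt_eqF// d0.
Unshelve. all: by end_near. Qed.

End Sums.

(** * Smoothing operators at nearby parameters *)

Section Smoothing.
Context {R : realType}.
Implicit Types (E : banach_scale R).

(** One constant for all exponents in [0, N], with the derivative of S_theta
integrated over [s, s']: unlike that derivative, S_s' - S_s is linear by
construction.  The second bound includes a = b, which spares case
distinctions. *)
Definition smoothing_estimates E (S : R -> E 0 -> E 0) (N K C : R) :=
  forall a b (s : R) (u : E 0), 0 <= a <= N -> 0 <= b <= N -> 1 <= s -> in_space a u ->
  [/\ b <= a -> space_norm b (S s u) <= C * space_norm a u,
      a <= b -> space_norm b (S s u) <= C * s `^ (b - a) * space_norm a u,
      b < a -> space_norm b (u - S s u) <= C * s `^ (b - a) * space_norm a u &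
      forall s', s <= s' -> s' <= K * s ->
        space_norm b (S s' u - S s u)
          <= C * ((s' - s) * s `^ (b - a - 1)) * space_norm a u].

(** The constant covers both signs of r, and is uniform for r <= N. *)
Lemma powR_le_ratio (K N r s x : R) : 1 <= K -> 0 <= N -> r <= N -> 0 < s -> s <= x -> x <= K * s ->
  x `^ r <= K `^ N * s `^ r.
Proof.
move=> K1 N0 rN s0 sx xK; have K0 := lt_le_trans ltr01 K1.
have x0 := lt_le_trans s0 sx.
have KN : 1 <= K `^ N by rewrite -(powRr0 K) ler_powR.
have [r0|r0] := leP 0 r.
  apply: (@le_trans _ _ ((K * s) `^ r)).
    by apply: (ge0_ler_powR r0 _ _ xK); rewrite nnegrE ?mulr_ge0// ltW.
  by rewrite powRM ?(ltW s0) ?(ltW K0)// ler_wpM2r ?powR_ge0// ler_powR.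
apply: (@le_trans _ _ (s `^ r)); last by rewrite ler_peMl ?powR_ge0.
rewrite -[r]opprK [X in X <= _]powRN [X in _ <= X]powRN.
rewrite lef_pV2 ?posrE ?powR_gt0//.
by apply: (ge0_ler_powR _ _ _ sx); rewrite ?nnegrE ?oppr_ge0 ltW.
Qed.

Lemma smoothing_estimatesP E (S : R -> E 0 -> E 0) (N K : R) : smoothing S ->
  0 <= N -> 1 <= K -> exists2 C, 1 <= C & smoothing_estimates S N K C.
Proof.
move=> [lS iS [dS [idS hdS /(_ N)[C HC]]]] N0 K1.
have KN : 1 <= K `^ N by rewrite -(powRr0 K) ler_powR.
pose D := Num.max C 1.
have D1 : 1 <= D by rewrite le_max lexx orbT.
have D0 : 0 <= D by apply: le_trans D1.
have CD : C <= D by rewrite le_max lexx.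
have KD : D <= D * K `^ N by rewrite ler_peMr.
exists (D * K `^ N); first by rewrite (le_trans D1).
move=> a b s u /[dup] aN /andP[a0 _] /[dup] bN /andP[b0 bN'] s1 ua.
have CDK : C <= D * K `^ N by apply: le_trans KD.
have [h1 h2 h3 h4] := HC _ _ _ _ aN bN s1 ua.
split.
- by move=> /h1 /le_trans; apply; rewrite ler_wpM2r ?space_norm_ge0.
- rewrite le_eqVlt => /orP[/eqP ab|/h2 /le_trans]; last first.
    by apply; rewrite ler_wpM2r ?space_norm_ge0// ler_wpM2r ?powR_ge0.
  have -> : b - a = 0 by rewrite ab subrr.
  have ba : b <= a by rewrite ab.
  rewrite powRr0 mulr1.
  by apply: (le_trans (h1 ba)); rewrite ler_wpM2r ?space_norm_ge0.
- by move=> /h3 /le_trans; apply; rewrite ler_wpM2r ?space_norm_ge0// ler_wpM2r ?powR_ge0.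
move=> s' ss' s'K.
set M := D * K `^ N * s `^ (b - a - 1) * space_norm a u.
have -> : D * K `^ N * ((s' - s) * s `^ (b - a - 1)) * space_norm a u = M * (s' - s).
  by rewrite /M; ring.
have Sb x : 1 <= x -> in_space b (S x u) by move=> x1; apply: iS.
rewrite -norm_lift.
have liftB x y : 1 <= x -> 1 <= y -> lift b (S y u - S x u) = lift b (S y u) - lift b (S x u).
  move=> x1 y1; rewrite -{1}(emb_lift (Sb x x1)) -{1}(emb_lift (Sb y y1)).
  by rewrite -linearB lift_emb.
have s'1 := le_trans s1 ss'.
rewrite liftB//; apply: (mean_value_le (f := fun x => lift b (S x u))) => // x /andP[sx xs'] e e0.
have x1 := le_trans s1 sx.
have /cvgrPdist_le /(_ e e0) := hdS x u b x1 b0.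
move=> /nbhs_ballP[d /= d0 Hd]; exists d => // y /andP[sy ys'] yd.
have y1 := le_trans s1 sy.
have [->|yx] := eqVneq y x; first by rewrite !subrr !normr0 mulr0.
have hyx : y - x != 0 by rewrite subr_eq0.
have := Hd (y - x); rewrite /ball/= sub0r normrN => /(_ yd hyx).
rewrite addrC subrK => /(_ y1); rewrite sub0r normrN (ger0_norm (space_norm_ge0 _ _)) => Hy.
rewrite -liftB// norm_lift.
have dSb : in_space b (dS x u) by apply: idS.
have qb : in_space b ((y - x)^-1 *: (S y u - S x u)).
  by apply: in_spaceZ; apply: in_spaceB; apply: Sb.
have : space_norm b ((y - x)^-1 *: (S y u - S x u)) <= M + e.
  rewrite -(subrK (dS x u) (_ *: _)) addrC.
  apply: (le_trans (space_normD b0 dSb (in_spaceB qb dSb))).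
  apply: lerD => //; have [_ _ _ /le_trans] := HC _ _ _ _ aN bN x1 ua; apply.
  rewrite /M ler_wpM2r ?space_norm_ge0//.
  apply: (@le_trans _ _ (D * x `^ (b - a - 1))); first by rewrite ler_wpM2r ?powR_ge0.
  rewrite -mulrA ler_wpM2l//; apply: powR_le_ratio => //.
  - lra.
  - by apply: lt_le_trans s1.
  - exact: le_trans s'K.
rewrite space_normZ// ?normfV; last by apply: in_spaceB; apply: Sb.
by rewrite ler_pdivrMl ?normr_gt0// mulrC.
Qed.

End Smoothing.

(** * Weak spaces: the operator estimate *)

Section Weak.
Context {R : realType}.
Implicit Types (E : banach_scale R) (theta : nat -> R).

Lemma powR_cvg0 theta (r : R) : (forall j, 0 < theta j) -> theta @ \oo --> +oo -> r < 0 ->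
  (fun n => theta n `^ r) @ \oo --> (0 : R).
Proof.
move=> tp /cvgryPge H r0; apply/cvgrPdist_le => e e0; near=> n.
rewrite sub0r normrN ger0_norm ?powR_ge0//.
have h1 : e `^ r^-1 <= theta n by near: n; apply: H.
rewrite -[r]opprK powRN -[leRHS]invrK lef_pV2 ?posrE ?invr_gt0 ?powR_gt0//.
have -> : e^-1 = (e `^ r^-1) `^ (- r).
  by rewrite -powRrM mulrN mulVf ?lt_eqF// powR_inv1 ?ltW.
by apply: (ge0_ler_powR _ _ _ h1); rewrite ?nnegrE ?powR_ge0 ?oppr_ge0 // ltW.
Unshelve. all: by end_near. Qed.

(** The first theta_j above s: its predecessor, if any, is below s. *)
Lemma admissible_hits theta s : admissible_seq theta -> 1 <= s -> forall K,
  1 <= K -> (forall j, theta j.+1 <= K * theta j) ->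
  exists j, s <= theta j /\ theta j <= K * s.
Proof.
move=> H s1 K K1 HK; case: (H) => t0 _ /cvgryPge /(_ s) too _.
have ex : exists n, s <= theta n.
  by case: too => n _ /(_ n (leqnn n)) sn; exists n.
exists (ex_minn ex); case: ex_minnP => -[|m] sm hm; split=> //.
  by rewrite t0 -[1]mulr1 ler_pM.
apply: le_trans (HK m) _; rewrite ler_wpM2l ?(le_trans _ K1)//.
by rewrite leNgt; apply/negP => /ltW /hm; rewrite ltnn.
Qed.

(** Why weak spaces do not depend on the choices: a linear operator A of
size L s^(-p) on E_p and L s^(-q) on E_q, with p < a < q, has size L s^(-a) on the
weak space of exponent a.  The terms with theta_i below s are estimated in E_q
and the others in E_p; each of the two sums is of the size of its term with
theta_i close to s. *)
Lemma weak_operator_bound theta (p q a : R) : admissible_seq theta ->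
  0 <= p -> p < a -> a < q -> exists2 C, 0 < C &
  forall E (u : E 0) (x : nat -> E q) M, weak_decomp theta p a u x M ->
  forall (A : E 0 -> E 0) (b s L : R), linear A -> 0 <= b -> 1 <= s -> 0 <= L ->
    (forall v, in_space p v -> in_space b (A v)) ->
    (forall v, in_space p v -> space_norm b (A v) <= L * s `^ (- p) * space_norm p v) ->
    (forall v, in_space q v -> space_norm b (A v) <= L * s `^ (- q) * space_norm q v) ->
  space_norm b (A u) <= C * M * L * s `^ (- a).
Proof.
move=> H p0 pa aq; have [K K1 HK] := admissible_ratio H.
have tp := admissible_gt0 H.
have q0 : 0 <= q by apply: le_trans p0 _; rewrite ltW// (lt_trans pa).
have [C1 C10 HC1] := @sum_pos_le _ theta (q - a) H ltac:(by rewrite subr_gt0).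
have [C2 C20 HC2] := @sum_neg_le _ theta (p - a) H ltac:(by rewrite subr_lt0).
have KN0 : 0 <= K `^ (q - a) by exact: powR_ge0.
exists (C1 * K `^ (q - a) + C2); first by rewrite ltr_wpDl// mulr_ge0// ltW.
move=> E u x M [xu xM] A b s L linA b0 s1 L0 Ab Ap Aq.
have s0 : 0 < s by apply: lt_le_trans s1.
have M0 : 0 <= M.
  have [_] := xM 0%N; case: H => -> _ _ _; rewrite powR1 mulr1.
  exact: le_trans.
have [y yu] := xu p p0 pa.
pose x0 i := emb E 0 q (x i).
have embp n : emb E 0 p (series (fun j => (theta j.+1 - theta j) *: emb E p q (x j)) n)
    = \sum_(0 <= i < n) (theta i.+1 - theta i) *: x0 i.
  rewrite /series/= linear_sum; apply: eq_bigr => i _.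
  by rewrite linearZ/= emb_trans// ltW// (lt_trans pa).
pose Alin := GRing.isLinear.Build R (E 0) (E 0) _ A linA.
pose Al : {linear E 0 -> E 0} := HB.pack A Alin.
have AE v : A v = Al v by [].
have xq i : in_space q (x0 i) by exact: in_space_emb.
have xp i : in_space p (x0 i) by apply: (in_space_mono p0 _ (xq i)); rewrite ltW// (lt_trans pa).
have xpM i : space_norm p (x0 i) <= M * theta i `^ (p - a - 1).
  have [h _] := xM i.
  by rewrite /x0 -(emb_trans (b0 := E) (lexx 0) p0 (ltW (lt_trans pa aq))) space_normE.
have xqM i : space_norm q (x0 i) <= M * theta i `^ (q - a - 1).
  by have [_ h] := xM i; rewrite /x0 space_normE.
have dt i : 0 <= theta i.+1 - theta i.
  by rewrite subr_ge0; case: H => _ /(_ i) /ltW.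
(* j separates the terms estimated in E_q from those estimated in E_p *)
have [j [sj jK]] := admissible_hits H s1 K1 HK.
have fin n : space_norm b (A (\sum_(0 <= i < n) (theta i.+1 - theta i) *: x0 i))
    <= (C1 * K `^ (q - a) + C2) * M * L * s `^ (- a).
  rewrite AE linear_sum.
  have Axb i : in_space b (Al ((theta i.+1 - theta i) *: x0 i)).
    by rewrite linearZ; apply: in_spaceZ; apply: Ab.
  apply: (le_trans (space_norm_sum b0 (fun i _ => Axb i))).
  pose r i := M * L * (s `^ (- q) * ((theta i.+1 - theta i) * theta i `^ (q - a - 1))).
  pose r' i := M * L * (s `^ (- p) * ((theta i.+1 - theta i) * theta i `^ (p - a - 1))).
  have r0 i : 0 <= r i by rewrite !mulr_ge0// powR_ge0.
  have r'0 i : 0 <= r' i by rewrite !mulr_ge0// powR_ge0.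
  have Ar i : space_norm b (Al ((theta i.+1 - theta i) *: x0 i)) <= r i.
    rewrite linearZ space_normZ//; last exact: Ab.
    rewrite ger0_norm//; apply: (le_trans (ler_wpM2l (dt i) (Aq _ (xq i)))).
    apply: (le_trans (ler_wpM2l (dt i) (ler_wpM2l _ (xqM i)))).
      by rewrite mulr_ge0// powR_ge0.
    by rewrite le_eqVlt /r; apply/orP; left; apply/eqP; ring.
  have Ar' i : space_norm b (Al ((theta i.+1 - theta i) *: x0 i)) <= r' i.
    rewrite linearZ space_normZ//; last exact: Ab.
    rewrite ger0_norm//; apply: (le_trans (ler_wpM2l (dt i) (Ap _ (xp i)))).
    apply: (le_trans (ler_wpM2l (dt i) (ler_wpM2l _ (xpM i)))).
      by rewrite mulr_ge0// powR_ge0.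
    by rewrite le_eqVlt /r'; apply/orP; left; apply/eqP; ring.
  apply: (@le_trans _ _ (\sum_(0 <= i < j) r i + \sum_(j <= i < n) r' i)).
    have [jn|nj] := leqP j n.
      by rewrite (big_cat_nat _ jn)//=; apply: lerD; apply: ler_sum => i _.
    rewrite [X in _ + X]big_geq ?(ltnW nj)// addr0.
    rewrite [leRHS](big_cat_nat (n := n))//= ?(ltnW nj)//.
    by rewrite ler_wpDr ?sumr_ge0//; apply: ler_sum.
  have hr : \sum_(0 <= i < j) r i <= M * L * (C1 * K `^ (q - a) * s `^ (- a)).
    rewrite /r -mulr_sumr -mulr_sumr ler_wpM2l ?mulr_ge0//.
    apply: (le_trans (ler_wpM2l (powR_ge0 _ _) (HC1 j))).
    have -> : C1 * K `^ (q - a) * s `^ (- a) = s `^ (- q) * (C1 * (K `^ (q - a) * s `^ (q - a))).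
      have -> : s `^ (- a) = s `^ (- q) * s `^ (q - a).
        by rewrite -powRD ?(gt_eqF s0) ?implybT//; congr (_ `^ _); ring.
      by ring.
    rewrite ler_wpM2l ?powR_ge0// ler_wpM2l ?(ltW C10)//.
    rewrite -powRM ?(ltW s0) ?(le_trans ler01 K1)//.
    by apply: (ge0_ler_powR _ _ _ jK);
      rewrite ?nnegrE ?subr_ge0 ?mulr_ge0 ?(ltW aq) ?(ltW s0) ?(ltW (tp j)) ?(le_trans ler01 K1).
  have hr' : \sum_(j <= i < n) r' i <= M * L * (C2 * s `^ (- a)).
    rewrite /r' -mulr_sumr -mulr_sumr ler_wpM2l ?mulr_ge0//.
    apply: (le_trans (ler_wpM2l (powR_ge0 _ _) (HC2 j n))).
    have -> : C2 * s `^ (- a) = s `^ (- p) * (C2 * s `^ (p - a)).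
      have -> : s `^ (- a) = s `^ (- p) * s `^ (p - a).
        by rewrite -powRD ?(gt_eqF s0) ?implybT//; congr (_ `^ _); ring.
      by ring.
    rewrite ler_wpM2l ?powR_ge0// ler_wpM2l ?(ltW C20)//.
    rewrite -[p - a]opprK [leLHS]powRN [leRHS]powRN lef_pV2 ?posrE ?powR_gt0//.
    by apply: (ge0_ler_powR _ _ _ sj); rewrite ?nnegrE ?oppr_ge0 ?subr_le0 ?(ltW pa) ?(ltW s0) ?(ltW (tp j)).
  apply: (le_trans (lerD hr hr')).
  by rewrite le_eqVlt; apply/orP; left; apply/eqP; ring.
move=> /cvgrPdist_le ylim; apply/ler_addgt0Pr => e e0.
have e1 : 0 < e / (L * s `^ (- p) + 1).
  by rewrite divr_gt0// ltr_wpDl// mulr_ge0// powR_ge0.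
(* A is continuous on E_p, where the decomposition converges, so that the bound
   on partial sums passes to the limit *)
have [n _ /(_ n (leqnn n)) Hn] := ylim _ e1.
set w := series _ n in Hn.
have -> : u = emb E 0 p (y - w) + \sum_(0 <= i < n) (theta i.+1 - theta i) *: x0 i.
  by rewrite linearB/= embp yu subrK.
rewrite AE linearD addrC.
apply: (le_trans (space_normD b0 _ _)); try by apply: Ab; last exact: in_space_emb.
  by apply: Ab; apply: in_space_sum => i _; apply: in_spaceZ.
apply: lerD; first exact: fin.
apply: (le_trans (Ap _ (in_space_emb _))); rewrite space_normE//.
have k0 : 0 <= L * s `^ (- p) by rewrite mulr_ge0// powR_ge0.
apply: (le_trans (ler_wpM2l k0 Hn)).
rewrite mulrCA ler_piMr ?(ltW e0)// ler_pdivrMr ?ltr_wpDl//.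
by rewrite mul1r lerDl.
Qed.

End Weak.

(** * Weak spaces: independence of the choices *)

Section WeakChange.
Context {R : realType}.
Implicit Types (E : banach_scale R) (theta : nat -> R).

Lemma weak_decomp_ge0 E theta (p q a : R) (u : E 0) (x : nat -> E q) M :
  admissible_seq theta -> weak_decomp theta p a u x M -> 0 <= M.
Proof.
move=> [t0 _ _ _] [_ /(_ 0%N)[_]]; rewrite t0 powR1 mulr1.
exact: le_trans.
Qed.

(** The operator estimate applied to the identity, to S_1 and to
S_s' - S_s. *)
Lemma weak_smoothing_bounds E (S : R -> E 0 -> E 0) theta (p q a N K : R) :
  smoothing S -> admissible_seq theta -> 1 <= K ->
  0 <= p -> p < a -> a < q -> q <= N -> exists2 C, 0 < C &
  forall (u : E 0) (x : nat -> E q) M, weak_decomp theta p a u x M ->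
  [/\ `|u| <= C * M,
      forall b, 0 <= b <= N -> space_norm b (S 1 u) <= C * M &
      forall b s s', 0 <= b <= N -> 1 <= s -> s <= s' -> s' <= K * s ->
        space_norm b (S s' u - S s u) <= C * M * ((s' - s) * s `^ (b - a - 1))].
Proof.
move=> hS H K1 p0 pa aq qN.
have pq : p <= q by rewrite ltW// (lt_trans pa).
have q0 : 0 <= q := le_trans p0 pq.
have N0 : 0 <= N := le_trans q0 qN.
have pN : 0 <= p <= N by rewrite p0 (le_trans pq).
have qN' : 0 <= q <= N by rewrite q0.
have [C C0 HC] := weak_operator_bound H p0 pa aq.
have [D D1 HD] := smoothing_estimatesP hS N0 K1.
have D0 : 0 <= D := le_trans ler01 D1.
exists (C * D); first by rewrite mulr_gt0// (lt_le_trans ltr01).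
move=> u x M ux; have M0 := weak_decomp_ge0 H ux.
have in0 (v : E 0) : in_space 0 v by exists v => //; exact: emb0.
case: (hS) => linS inS _.
split.
- have := HC _ _ _ _ ux (fun v => v) 0 1 1.
  rewrite !powR1 !mulr1 space_norm0 => h.
  apply: (@le_trans _ _ (C * M)); last first.
    by rewrite [C * D]mulrC -mulrA ler_peMl// mulr_ge0// ltW.
  apply: h => //; move=> v vs; rewrite space_norm0 mul1r; exact: norm_le_space_norm.
- move=> b /[dup] bN /andP[b0 _].
  have := HC _ _ _ _ ux (S 1) b 1 D (linS 1 (lexx 1)) b0 (lexx 1) D0.
  rewrite !powR1 !mulr1 mulrAC; apply.
  + by move=> v _; apply: inS.
  (* at parameter 1 the powers are 1, whichever of b and p is larger *)
  + move=> v vp; have [h1 h2 _ _] := HD p b 1 v pN bN (lexx 1) vp.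
    by have [/h1//|/ltW/h2] := leP b p; rewrite powR1 mulr1.
  + move=> v vp; have [h1 h2 _ _] := HD q b 1 v qN' bN (lexx 1) vp.
    by have [/h1//|/ltW/h2] := leP b q; rewrite powR1 mulr1.
- move=> b s s' /[dup] bN /andP[b0 _] s1 ss' s'K.
  have s0 : 0 < s := lt_le_trans ltr01 s1.
  have s'1 : 1 <= s' := le_trans s1 ss'.
  pose L := D * ((s' - s) * s `^ (b - 1)).
  have L0 : 0 <= L by rewrite !mulr_ge0 ?powR_ge0// subr_ge0.
  have sE r : L * s `^ (- r) = D * ((s' - s) * s `^ (b - r - 1)).
    rewrite /L -!mulrA -powRD ?(gt_eqF s0) ?implybT//.
    by congr (_ * (_ * _ `^ _)); ring.
  have -> : C * D * M * ((s' - s) * s `^ (b - a - 1)) = C * M * L * s `^ (- a).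
    by rewrite -mulrA -[in RHS]mulrA sE; ring.
  apply: (HC _ _ _ _ ux (fun v => S s' v - S s v)) => //.
  + by move=> k v w; rewrite linS// linS//; rewrite scalerBr opprD addrACA.
  + by move=> v _; apply: in_spaceB; apply: inS.
  + move=> v vp; have [_ _ _ h] := HD p b s v pN bN s1 vp.
    by rewrite sE; apply: h.
  + move=> v vp; have [_ _ _ h] := HD q b s v qN' bN s1 vp.
    by rewrite sE; apply: h.
Qed.

(** Convergence in E_0 only needs some positive regularity of u; convergence
in the better spaces is recovered by absolute convergence. *)
Lemma smoothing_approx E (S : R -> E 0 -> E 0) theta (r : R) (u : E 0) :
  smoothing S -> admissible_seq theta -> 0 < r -> in_space r u ->
  (fun n => S (theta n) u) @ \oo --> u.
Proof.
move=> hS H r0 ur.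
have [D D1 HD] := smoothing_estimatesP hS (ltW r0) (lexx 1).
have t1 := admissible_ge1 H.
have est n : `|u - S (theta n) u| <= D * space_norm r u * theta n `^ (- r).
  have rr : 0 <= r <= r by rewrite lexx andbT ltW.
  have r00 : 0 <= (0 : R) <= r by apply/andP; split=> //; exact: ltW.
  have [_ _ /(_ r0) h _] := HD r 0 (theta n) u rr r00 (t1 n) ur.
  by rewrite -(space_norm0 (_ - _)) mulrAC -[- r]sub0r.
case: (H) => _ _ too _.
have /cvgrPdist_le lim0 := @powR_cvg0 _ theta (- r) (admissible_gt0 H) too ltac:(by rewrite oppr_lt0).
have B0 : 0 < D * space_norm r u + 1.
  by rewrite ltr_wpDl// mulr_ge0 ?space_norm_ge0// (le_trans ler01).
apply/cvgrPdist_le => e e0; near=> n.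
apply: (le_trans (est n)).
apply: (@le_trans _ _ ((D * space_norm r u + 1) * theta n `^ (- r))).
  by rewrite ler_wpM2r ?powR_ge0// lerDl.
rewrite mulrC -ler_pdivlMr//.
rewrite -[leLHS]ger0_norm ?powR_ge0// -normrN -sub0r.
by near: n; apply: lim0; rewrite divr_gt0.
Unshelve. all: by end_near. Qed.

Lemma weak_in_space E theta (p q a : R) (u : E 0) (x : nat -> E q) M b :
  weak_decomp theta p a u x M -> 0 <= b -> b < a -> in_space b u.
Proof. by move=> [h _] b0 ba; have [y <- _] := h b b0 ba; exact: in_space_emb. Qed.

(** The new terms are the increments of S_theta' u divided by those of theta';
the term of index 0 also carries S_1 u.  Their partial sums are the S_theta'_n u. *)
Lemma weak_change E (S : R -> E 0 -> E 0) theta theta' (p q p' q' a : R) :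
  smoothing S -> admissible_seq theta -> admissible_seq theta' ->
  0 <= p -> p < a -> a < q -> 0 <= p' -> p' < a -> a < q' -> exists2 C, 0 < C &
  forall (u : E 0) (x : nat -> E q) M, weak_decomp theta p a u x M ->
    exists x' : nat -> E q', weak_decomp theta' p' a u x' (C * M).
Proof.
move=> hS H H' p0 pa aq p'0 p'a aq'.
pose N := Num.max q q'.
have qN : q <= N by rewrite le_max lexx.
have q'N : q' <= N by rewrite le_max lexx orbT.
have a0 : 0 <= a by rewrite (le_trans p0)// ltW.
have q'0 : 0 <= q' by rewrite (le_trans a0)// ltW.
have aN : a <= N by rewrite (le_trans _ qN)// ltW.
have [K K1 HK] := admissible_ratio H'.
have [C C0 HC] := weak_smoothing_bounds hS H K1 p0 pa aq qN.
have t'1 := admissible_ge1 H'; have t'p := admissible_gt0 H'.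
case: (hS) => linS inS _.
case: (H') => t'0 t'S t'oo _.
have gap i : 0 < theta' i.+1 - theta' i by rewrite subr_gt0.
pose g0 := theta' 1%N - theta' 0%N.
exists (C * (1 + g0^-1)); first by rewrite mulr_gt0// addr_gt0// invr_gt0 gap.
move=> u x M ux; have M0 := weak_decomp_ge0 H ux.
have [_ HC1 HC2] := HC _ _ _ ux.
pose B := C * (1 + g0^-1) * M.
have CM0 : 0 <= C * M by rewrite mulr_ge0// ltW.
pose y i := (theta' i.+1 - theta' i)^-1 *:
  (S (theta' i.+1) u - S (theta' i) u + (if i == 0%N then S 1 u else 0)).
have yin i b : 0 <= b -> in_space b (y i).
  move=> b0; apply: in_spaceZ; apply: in_spaceD.
    by apply: in_spaceB; apply: inS.
  by case: ifP => _; [exact: inS | exact: in_space_zero].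
have yB i b : 0 <= b <= N -> space_norm b (y i) <= B * theta' i `^ (b - a - 1).
  move=> bN; have b0 : 0 <= b by case/andP: bN.
  have in1 : in_space b (S (theta' i.+1) u - S (theta' i) u).
    by apply: in_spaceB; apply: inS.
  have in2 : in_space b (if i == 0%N then S 1 u else 0).
    by case: ifP => _; [exact: inS | exact: in_space_zero].
  rewrite space_normZ//; last exact: in_spaceD.
  rewrite gtr0_norm ?invr_gt0// ler_pdivrMl//.
  apply: (le_trans (space_normD b0 in1 in2)).
  have h := HC2 b (theta' i) (theta' i.+1) bN (t'1 i) (ltW (t'S i)) (HK i).
  have -> : (theta' i.+1 - theta' i) * (B * theta' i `^ (b - a - 1)) =
      C * M * ((theta' i.+1 - theta' i) * theta' i `^ (b - a - 1))
    + C * M * g0^-1 * ((theta' i.+1 - theta' i) * theta' i `^ (b - a - 1)).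
    by rewrite /B; ring.
  apply: lerD => //; case: eqP => [->|_]; last first.
    rewrite space_norm_zero// !mulr_ge0 ?powR_ge0 ?(ltW (gap _)) ?(ltW C0)//.
    by rewrite invr_ge0 ltW// gap.
  rewrite t'0 powR1 mulr1 -/g0 -t'0 -/g0 -mulrA mulVf ?mulr1 ?gt_eqF ?gap//.
  by rewrite t'0; exact: HC1.
pose x' i : E q' := lift q' (y i).
exists x'.
have x'b i b : 0 <= b -> b <= q' -> `|emb E b q' (x' i)| = space_norm b (y i).
  by move=> b0 bq; rewrite -space_normE// emb_trans// emb_lift//; apply: yin.
have p'q' : p' <= q' by rewrite ltW// (lt_trans p'a).
split; last first.
  move=> i; split.
    by rewrite x'b//; apply: yB; rewrite p'0 (le_trans p'q').
  by rewrite norm_lift; apply: yB; rewrite q'0.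
move=> b b0 ba; have bq' : b <= q' by rewrite ltW// (lt_trans ba).
have bN : 0 <= b <= N by rewrite b0 (le_trans bq').
have [C2 C20 HC2'] := @sum_neg_le _ theta' (b - a) H' ltac:(by rewrite subr_lt0).
apply: (@abs_cvg_in_space _ _ _ _
  (fun i => B * ((theta' i.+1 - theta' i) * theta' i `^ (b - a - 1)))
  (B * (C2 * theta' 0%N `^ (b - a)))) => //.
- move=> i; rewrite normrZ gtr0_norm// x'b// mulrCA ler_wpM2l ?(ltW (gap i))//.
  exact: yB.
- move=> n; rewrite -mulr_sumr ler_wpM2l//.
  by rewrite !mulr_ge0 ?(ltW C0)// addr_ge0// invr_ge0 ltW// gap.
- rewrite (_ : (fun i => _) = fun i => (theta' i.+1 - theta' i) *: y i); last first.
    apply/funext => i; rewrite linearZ/= emb_trans// emb_lift//.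
    exact: yin.
  rewrite -cvg_shiftS/=.
  rewrite (_ : (fun n => _) = fun n => S (theta' n.+1) u); last first.
    apply/funext; elim=> [|n IH].
      rewrite /series/= big_nat1 /y/= scalerA divff ?gt_eqF ?gap// scale1r.
      by rewrite t'0 subrK.
    rewrite /series/= in IH *; rewrite big_nat_recr//= IH /y/= scalerA divff ?gt_eqF ?gap// scale1r addr0.
    by rewrite addrC subrK.
  rewrite (cvg_shiftS (fun n => S (theta' n) u)).
  (* any exponent strictly between 0 and a would do *)
  have a20 : 0 < a / 2.
    by rewrite divr_gt0// (le_lt_trans p0).
  apply: (smoothing_approx hS H' a20).
  apply: (weak_in_space ux (ltW a20)).
  by rewrite ltr_pdivrMr// ltr_pMr ?ltr1n// (le_lt_trans p0).
Qed.

End WeakChange.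

(** * Taylor estimates for maps of class C^2 *)

Section Taylor.
Context {R : realType} (U W : normedModType R) (A : set U) (f : U -> W)
  (df : U -> {linear U -> W}) (d2f : U -> {bilinear U -> U -> W}).
Hypothesis fC2 : C2_on A f df d2f.

Lemma segment_near (u h : U) (P : set U) (t : R) :
  nbhs (u + t *: h) P -> exists2 d : R, 0 < d & forall s, `|s - t| < d -> P (u + s *: h).
Proof.
move=> /nbhs_ballP[d d0 dP]; exists (d / (`|h| + 1)).
  by rewrite divr_gt0// ltr_wpDl.
move=> s std; apply: dP; rewrite -ball_normE/=.
rewrite opprD addrACA subrr add0r -scalerBl normrZ distrC.
apply: (@le_lt_trans _ _ (`|s - t| * (`|h| + 1))).
  by rewrite ler_wpM2l// lerDl.
by rewrite -ltr_pdivlMr// ltr_wpDl.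
Qed.

Lemma C2_df_le (u h w : U) (M : R) :
  (forall t, 0 <= t <= 1 -> A (u + t *: h)) ->
  (forall t, 0 <= t <= 1 -> `|d2f (u + t *: h) h w| <= M) ->
  `|df (u + h) w - df u w| <= M.
Proof.
move=> hA hM.
have := @mean_value_le R W (fun t => df (u + t *: h) w) 0 1 M ler01.
rewrite scale1r scale0r addr0 subr0 mulr1; apply.
move=> t t01 e e0.
have [_ _ _ hd _] := fC2 (hA t t01).
have k0 : 0 < `|h| * `|w| + 1 by rewrite ltr_wpDl// mulr_ge0.
have [d d0 Hd] := segment_near (hd (e / (`|h| * `|w| + 1)) (divr_gt0 e0 k0)).
exists d => // s s01 /Hd /(_ (hA s s01) w).
have -> : u + s *: h - (u + t *: h) = (s - t) *: h.
  by rewrite opprD addrACA subrr add0r scalerBl.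
rewrite linearZl_LR normrZ => H.
rewrite -[X in `|X|](subrK ((s - t) *: d2f (u + t *: h) h w)).
apply: (le_trans (ler_normD _ _)); rewrite normrZ mulrDl addrC.
apply: lerD.
  by rewrite mulrC ler_wpM2r// hM.
apply: (le_trans H).
have -> : e / (`|h| * `|w| + 1) * (`|s - t| * `|h|) * `|w| =
  e * `|s - t| * ((`|h| * `|w|) / (`|h| * `|w| + 1)) by ring.
by rewrite ler_piMr ?mulr_ge0 ?(ltW e0)// ler_pdivrMr// mul1r lerDl.
Qed.

(** Two applications of the mean value inequality instead of an integral
remainder, hence the constant 1 in place of 1/2. *)
Lemma C2_taylor_le (u h : U) (M : R) :
  (forall t, 0 <= t <= 1 -> A (u + t *: h)) ->
  (forall t, 0 <= t <= 1 -> `|d2f (u + t *: h) h h| <= M) ->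
  `|f (u + h) - f u - df u h| <= M.
Proof.
move=> hA hM.
have hdf t : 0 <= t <= 1 -> `|df (u + t *: h) h - df u h| <= M.
  move=> /andP[t0 t1]; apply: C2_df_le => s /andP[s0 s1].
    by rewrite scalerA; apply: hA; rewrite mulr_ge0//= mulr_ile1.
  rewrite scalerA linearZl_LR normrZ ger0_norm//.
  apply: (@le_trans _ _ (1 * `|d2f (u + (s * t) *: h) h h|)).
    by rewrite ler_wpM2r.
  by rewrite mul1r hM// mulr_ge0//= mulr_ile1.
have := @mean_value_le R W (fun t => f (u + t *: h) - t *: df u h) 0 1 M ler01.
rewrite !scale1r !scale0r addr0 !subr0 mulr1 addrAC; apply.
move=> t t01 e e0.
have [_ _ hd _ _] := fC2 (hA t t01).
have k0 : 0 < `|h| + 1 by rewrite ltr_wpDl.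
have [d d0 Hd] := segment_near (hd (e / (`|h| + 1)) (divr_gt0 e0 k0)).
exists d => // s s01 /Hd /(_ (hA s s01)).
have -> : u + s *: h - (u + t *: h) = (s - t) *: h.
  by rewrite opprD addrACA subrr add0r scalerBl.
rewrite linearZ normrZ => H.
have -> : f (u + s *: h) - s *: df u h - (f (u + t *: h) - t *: df u h) =
  (f (u + s *: h) - f (u + t *: h) - (s - t) *: df (u + t *: h) h)
  + (s - t) *: (df (u + t *: h) h - df u h).
  rewrite scalerBr addrA subrK scalerBl !opprB -!addrA; congr (_ + _).
  by rewrite addrCA [RHS]addrCA; congr (_ + _); rewrite addrC.
apply: (le_trans (ler_normD _ _)); rewrite normrZ mulrDl addrC.
apply: lerD.
  by rewrite mulrC ler_wpM2r// hdf.
apply: (le_trans H).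
have -> : e / (`|h| + 1) * (`|s - t| * `|h|) =
  e * `|s - t| * (`|h| / (`|h| + 1)) by ring.
by rewrite ler_piMr ?mulr_ge0 ?(ltW e0)// ler_pdivrMr// mul1r lerDl.
Qed.

(** The error of a Newton step at u when the derivative is taken at the smoothed
point v: the Taylor remainder at u plus the change of derivative from v to u. *)
Lemma C2_newton_error (u v h : U) (M1 M2 : R) :
  (forall t, 0 <= t <= 1 -> A (v + t *: (u - v))) ->
  (forall t, 0 <= t <= 1 -> A (u + t *: h)) ->
  (forall t, 0 <= t <= 1 -> `|d2f (v + t *: (u - v)) (u - v) h| <= M1) ->
  (forall t, 0 <= t <= 1 -> `|d2f (u + t *: h) h h| <= M2) ->
  `|f (u + h) - f u - df v h| <= M1 + M2.
Proof.
move=> hA1 hA2 h1 h2.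
have := C2_df_le hA1 h1; rewrite (addrC v) subrK => e1.
have e2 := C2_taylor_le hA2 h2.
rewrite -(subrK (df u h) (f (u + h) - f u)) -addrA addrC.
by apply: (le_trans (ler_normD _ _)); exact: lerD.
Qed.

Lemma C2_continuous_within (u : U) : A u ->
  f x @[x --> within A (nbhs u)] --> f u.
Proof.
move=> Au; have [cdf _ hd _ _] := fC2 Au.
have c0 : df u x @[x --> nbhs 0] --> (0 : W).
  by have := cdf 0; rewrite /continuous_at linear0.
apply/cvgrPdist_le => e e0.
have e20 : 0 < e / 2 by rewrite divr_gt0.
have [d d0 Hd] : exists2 d, 0 < d & forall x, `|x| < d -> `|df u x| <= e / 2.
  move/cvgrPdist_le: c0 => /(_ _ e20) /nbhs_ballP[d d0 Hd].
  exists d => // x xd; rewrite -normrN -sub0r; apply: Hd.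
  by rewrite -ball_normE/= sub0r normrN.
near=> x.
rewrite distrC -[X in `|X|](subrK (df u (x - u))).
apply: (le_trans (ler_normD _ _)).
rewrite [leRHS]splitr; apply: lerD.
  apply: (@le_trans _ _ (e / 2 * `|x - u|)).
    by near: x; exact: hd.
  rewrite ler_piMr ?(ltW e20)//; near: x; apply: cvg_within.
  by apply/nbhs_ballP; exists 1 => //= y; rewrite -ball_normE/= distrC => /ltW.
apply: (Hd (x - u)); near: x; apply: cvg_within.
by apply/nbhs_ballP; exists d => //= y; rewrite -ball_normE/= distrC.
Unshelve. all: by end_near. Qed.

End Taylor.

(** * Taylor estimates on a scale *)

Section Level.
Context {R : realType} (E F : banach_scale R) (mu a0 : R).
Context (V : set (E mu)) (Phi : E mu -> F 0).
Context (dPhi : E mu -> E mu -> F 0) (d2Phi : E mu -> E mu -> E mu -> F 0).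
Context (c a C1 r : R).
Hypothesis a_ge0 : 0 <= a.
Hypothesis mu_ge0 : 0 <= mu.
Hypothesis mu_le_c : mu <= c.
Hypothesis C1_ge0 : 0 <= C1.
Hypothesis ball_V : forall x : E mu, `|x| < r -> V x.
Hypothesis Phi_C2 : C2_level V Phi dPhi d2Phi c a.
Hypothesis d2Phi_le : forall u v w : E c, V (emb E mu c u) ->
  space_norm a (d2Phi (emb E mu c u) (emb E mu c v) (emb E mu c w))
    <= C1 * (`|v| * `|emb E a0 c w| + `|emb E a0 c v| * `|w|
             + `|u| * `|emb E a0 c v| * `|emb E a0 c w|).

(** P bounds the increments in the norm of E_c, Q their norm in E_a0, and W the
points of the segments in E_c.  With c = a + mu, the pair (c, a) is kept free of the equation
so that the lemma applies to (mu, 0) without transport between E_(0 + mu) and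
E_mu. *)
Lemma level_newton_error (u v h : E c) (P Q W : R) :
  `|emb E mu c u| < r / 2 -> `|emb E mu c v| < r / 2 -> `|emb E mu c h| < r / 2 ->
  `|u - v| <= P -> `|h| <= P -> `|emb E a0 c (u - v)| <= Q -> `|emb E a0 c h| <= Q ->
  `|u| + `|v| + `|h| <= W ->
  let X := Phi (emb E mu c (u + h)) - Phi (emb E mu c u)
           - dPhi (emb E mu c v) (emb E mu c h) in
  in_space a X /\ space_norm a X <= 2 * C1 * (2 * P * Q + W * Q ^+ 2).
Proof.
move=> ur vr hr uvP hP uvQ hQ uvhW X.
have P0 : 0 <= P := le_trans (normr_ge0 _) hP.
have Q0 : 0 <= Q := le_trans (normr_ge0 _) hQ.
have W0 : 0 <= W by apply: le_trans uvhW; rewrite !addr_ge0.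
have [f [df [d2f [fC2 fE]]]] := Phi_C2.
have halfr : r / 2 <= r.
  have : 0 <= r / 2 by apply: le_trans (ltW ur).
  lra.
have Vu : V (emb E mu c u) by apply: ball_V; exact: lt_le_trans halfr.
have Vv : V (emb E mu c v) by apply: ball_V; exact: lt_le_trans halfr.
have seg1 t : 0 <= t <= 1 -> V (emb E mu c (v + t *: (u - v))).
  move=> /andP[t0 t1]; apply: ball_V.
  have -> : v + t *: (u - v) = (1 - t) *: v + t *: u.
    by rewrite scalerBr scalerBl scale1r addrA addrAC.
  rewrite linearD !linearZ; apply: (le_lt_trans (ler_normD _ _)).
  rewrite !normrZ (ger0_norm t0) ger0_norm ?subr_ge0//.
  apply: (@le_lt_trans _ _ ((1 - t) * (r / 2) + t * (r / 2))); last first.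
    have : 0 < r / 2 by apply: le_lt_trans ur.
    lra.
  by apply: lerD; apply: ler_wpM2l; rewrite ?subr_ge0// ltW.
have seg2 t : 0 <= t <= 1 -> V (emb E mu c (u + t *: h)).
  move=> /andP[t0 t1]; apply: ball_V.
  rewrite linearD linearZ; apply: (le_lt_trans (ler_normD _ _)).
  rewrite normrZ (ger0_norm t0) [ltRHS]splitr; apply: ltr_leD => //.
  apply: le_trans (ltW hr); rewrite -[leRHS]mul1r.
  by rewrite ler_wpM2r.
have d2le z y w M : V (emb E mu c z) -> `|z| <= W ->
    `|y| <= P -> `|emb E a0 c y| <= Q -> `|w| <= P -> `|emb E a0 c w| <= Q ->
    M = C1 * (2 * P * Q + W * Q ^+ 2) -> `|d2f z y w| <= M.
  move=> Vz zW yP yQ wP wQ ->.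
  have [_ _ h2] := fE z Vz.
  rewrite -space_normE// h2; apply: (le_trans (d2Phi_le _ _ Vz)).
  apply: ler_wpM2l => //.
  have -> : 2 * P * Q + W * Q ^+ 2 = P * Q + Q * P + W * Q * Q by ring.
  by rewrite !lerD// !ler_pM// mulr_ge0.
have est : `|f (u + h) - f u - df v h| <= 2 * C1 * (2 * P * Q + W * Q ^+ 2).
  rewrite -mulrA mulrDl mul1r; apply: (C2_newton_error fC2) => // t t01.
  - apply: d2le (seg1 _ t01) _ _ _ _ _ erefl => //.
    apply: le_trans uvhW; case/andP: t01 => t0 t1.
    have -> : v + t *: (u - v) = (1 - t) *: v + t *: u.
      by rewrite scalerBr scalerBl scale1r addrA addrAC.
    apply: (le_trans (ler_normD _ _)).
    rewrite !normrZ (ger0_norm t0) ger0_norm ?subr_ge0// addrC ler_wpDr//.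
    by apply: lerD; rewrite ler_piMl// lerBlDr lerDl.
  - apply: d2le (seg2 _ t01) _ _ _ _ _ erefl => //.
    apply: le_trans uvhW; case/andP: t01 => t0 t1.
    apply: (le_trans (ler_normD _ _)).
    by rewrite normrZ (ger0_norm t0) -addrA lerD// ler_wpDl// ler_piMl.
have uh : V (emb E mu c (u + h)).
  by have := seg2 1; rewrite scale1r; apply; rewrite ler01 lexx.
have XE : X = emb F 0 a (f (u + h) - f u - df v h).
  rewrite !linearB/=; have [-> _ _] := fE _ uh; have [-> _ _] := fE _ Vu.
  by have [_ -> _] := fE _ Vv.
by rewrite XE; split; [exact: in_space_emb | rewrite space_normE].
Qed.

End Level.

Lemma Phi_cvg (R : realType) (E F : banach_scale R) (mu c : R)
  (V : set (E mu)) (Phi : E mu -> F 0)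
  (dPhi : E mu -> E mu -> F 0) (d2Phi : E mu -> E mu -> E mu -> F 0) :
  C2_level V Phi dPhi d2Phi c 0 -> forall (x : nat -> E c) (y : E c),
  (forall n, V (emb E mu c (x n))) -> V (emb E mu c y) -> x @ \oo --> y ->
  (fun n => Phi (emb E mu c (x n))) @ \oo --> Phi (emb E mu c y).
Proof.
move=> [f [df [d2f [fC2 fE]]]] x y Vx Vy xy.
have PhiE z : V (emb E mu c z) -> Phi (emb E mu c z) = f z.
  by move=> Vz; have [<- _ _] := fE _ Vz; rewrite emb0.
rewrite PhiE//; under eq_fun do rewrite PhiE//.
apply: (@cvg_comp _ _ _ x f _ _ _ _ (C2_continuous_within fC2 Vy)) => B HB.
have H : \forall n \near \oo, V (emb E mu c (x n)) -> B (x n) := xy _ HB.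
have : \forall n \near \oo, B (x n) by apply: filterS H => n; apply; exact: Vx.
by [].
Qed.

(** * Powers of the dyadic sequence *)

Section DyadicPowers.
Context {R : realType}.
Implicit Types (s : R) (k : nat).

Definition dpow k s : R := dyadic k `^ s.

Lemma dyadic_gt0 k : 0 < dyadic k :> R.
Proof. by rewrite exprn_gt0. Qed.

Lemma dyadic_ge1 k : 1 <= dyadic k :> R.
Proof. by rewrite exprn_ege1 ?ler1n. Qed.

Lemma dpow_ge0 k s : 0 <= dpow k s.
Proof. exact: powR_ge0. Qed.

Lemma dpowD k s s' : dpow k (s + s') = dpow k s * dpow k s'.
Proof. by rewrite /dpow powRD// (gt_eqF (dyadic_gt0 k)) implybT. Qed.

Lemma dpow_le k s s' : s <= s' -> dpow k s <= dpow k s'.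
Proof. by move=> ss'; apply: ler_powR => //; exact: dyadic_ge1. Qed.

Lemma dpow_le1 k s : s <= 0 -> dpow k s <= 1.
Proof. by move=> s0; rewrite -(powRr0 (dyadic k)); exact: dpow_le. Qed.

Lemma dpow0 s : dpow 0 s = 1.
Proof. by rewrite /dpow /dyadic expr0 powR1. Qed.

Lemma dpowS k s : dpow k.+1 s = 2 `^ s * dpow k s.
Proof. by rewrite /dpow /dyadic exprS powRM// exprn_ge0. Qed.

Lemma dyadic_dpow k s : dyadic k * dpow k (s - 1) = dpow k s.
Proof.
by rewrite dpowD /dpow powR_inv1 ?(ltW (dyadic_gt0 k))// mulrCA divff ?mulr1// gt_eqF// dyadic_gt0.
Qed.

Lemma dpow_homo i k s : 0 <= s -> (i <= k)%N -> dpow i s <= dpow k s.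
Proof.
move=> s0 ik; apply: (ge0_ler_powR s0); rewrite ?nnegrE ?(ltW (dyadic_gt0 _))//.
exact: (admissible_homo (@dyadic_admissible R)).
Qed.

(** The constant is uniform for s' >= s, because
dpow i s' <= dpow i s * dpow k (s' - s) for i < k. *)
Lemma dpow_sum_pos s : 0 < s -> exists2 A, 0 < A &
  forall s', s <= s' -> forall k, \sum_(0 <= i < k) dpow i s' <= A * dpow k s'.
Proof.
move=> s0; have [A A0 HA] := sum_pos_le (@dyadic_admissible R) s0.
exists A => // s' ss' k.
have -> : s' = s + (s' - s) by ring.
apply: (@le_trans _ _ (\sum_(0 <= i < k) dpow i s * dpow k (s' - s))).
  rewrite big_nat [leRHS]big_nat; apply: ler_sum => i /andP[_ ik].
  by rewrite dpowD ler_wpM2l ?dpow_ge0// dpow_homo ?subr_ge0// ltnW.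
rewrite -mulr_suml (dpowD k s) mulrA ler_wpM2r ?dpow_ge0//.
apply: le_trans (HA k); rewrite le_eqVlt; apply/orP; left; apply/eqP.
by apply: eq_bigr => i _; rewrite dyadic_gap -/(dpow _ _) dyadic_dpow.
Qed.

Lemma dpow_sum_neg s : s < 0 -> exists2 A, 0 < A &
  forall k, \sum_(0 <= i < k) dpow i s <= A.
Proof.
move=> s0; have [A A0 HA] := sum_neg_le (@dyadic_admissible R) s0.
exists A => // k; have := HA 0%N k; rewrite -/(dpow 0 s) dpow0 mulr1.
apply: le_trans; rewrite le_eqVlt; apply/orP; left; apply/eqP.
by apply: eq_bigr => i _; rewrite dyadic_gap -/(dpow _ _) dyadic_dpow.
Qed.

Lemma dpow_cvg0 s : s < 0 -> (fun k => dpow k s) @ \oo --> (0 : R).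
Proof.
move=> s0; apply: powR_cvg0 => //; first exact: dyadic_gt0.
by case: (@dyadic_admissible R).
Qed.

Lemma dpow_squeeze0 (W : normedModType R) (z : nat -> W) (c s : R) : s < 0 ->
  (forall k, `|z k| <= c * dpow k s) -> z @ \oo --> (0 : W).
Proof.
move=> s0 zs; apply/norm_cvg0P.
apply: (@squeeze_cvgr _ _ _ _ (fun=> 0) (fun k => c * dpow k s)).
- by near=> k; rewrite normr_ge0 zs.
- exact: cvg_cst.
- by rewrite -[X in _ --> X](mulr0 c); apply: cvgMr; exact: dpow_cvg0.
Unshelve. all: by end_near. Qed.

End DyadicPowers.

(** * The Newton iteration with smoothing *)

Lemma sub_diffs (W : zmodType) (x y z c d : W) :
  (x - z - c) - (y - z - d) = x - y - (c - d).
Proof.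
rewrite (opprD (y - z)) addrACA opprB (addrA (x - z)) subrK opprK.
by rewrite opprB [- c + d]addrC.
Qed.

Lemma sub_increments (W : zmodType) (a b c d e : W) :
  (a - (b + c)) - (d - e) = (a - d) - (b - e) - c.
Proof.
rewrite [in LHS]opprD addrA [LHS]addrAC; congr (_ - _).
rewrite !opprB -!addrA; congr (_ + _).
by rewrite addrCA [RHS]addrCA; congr (_ + _); rewrite addrC.
Qed.

Section Iteration.
Context {R : realType} (E F : banach_scale R).
Context (SE : R -> E 0 -> E 0) (SF : R -> F 0 -> F 0).
Context (a1 a2 alpha beta a0 mu : R).
Hypotheses (hSE : smoothing SE) (hSF : smoothing SF).
Hypotheses (ha0 : 0 <= a0) (ha0mu : a0 <= mu) (hmua1 : mu <= a1).
Hypotheses (beta_gt0 : 0 < beta) (halpha1 : a1 + beta / 2 <= alpha)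
  (halpha2 : alpha < a1 + beta) (ha2 : a1 + beta <= a2) (h2alpha : 2 * alpha < a1 + a2).
Context (V : set (E mu)) (Phi : E mu -> F 0).
Context (dPhi : E mu -> E mu -> F 0) (d2Phi : E mu -> E mu -> E mu -> F 0).
Context (Psi : E mu -> F 0 -> E a2).
Context (r delta1 C1 C2 D A : R).
Hypothesis ball_V : forall x : E mu, `|x| < r -> V x.
Hypotheses (C1_ge0 : 0 <= C1) (C2_ge0 : 0 <= C2) (D_ge1 : 1 <= D) (A_ge1 : 1 <= A).
Hypothesis Phi_C2 : forall c a, c = a + mu -> 0 <= a -> a <= a2 - mu ->
  C2_level V Phi dPhi d2Phi c a.
Hypothesis d2Phi_le : forall c a, c = a + mu -> 0 <= a -> a <= a2 - mu ->
  forall u v w : E c, V (emb E mu c u) ->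
  space_norm a (d2Phi (emb E mu c u) (emb E mu c v) (emb E mu c w))
    <= C1 * (`|v| * `|emb E a0 c w| + `|emb E a0 c v| * `|w|
             + `|u| * `|emb E a0 c v| * `|emb E a0 c w|).
Hypothesis Psi_inv : forall (v : E mu) (g : F 0),
  V v -> in_infty (emb E 0 mu v) ->
  space_norm a1 (emb E 0 mu v) <= delta1 -> in_infty g ->
  dPhi v (emb E mu a2 (Psi v g)) = g.
Hypothesis Psi_le : forall (v : E mu) (g : F 0),
  V v -> in_infty (emb E 0 mu v) ->
  space_norm a1 (emb E 0 mu v) <= delta1 -> in_infty g ->
  forall a : R, a1 <= a -> a <= a2 ->
  `|emb E a a2 (Psi v g)|
    <= C2 * (space_norm (a + beta - alpha) g
             + `|g| * space_norm (a + beta) (emb E 0 mu v)).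
Hypothesis SE_le : smoothing_estimates SE (a2 + beta) 2 D.
Hypothesis SF_le : smoothing_estimates SF (a2 + beta) 2 D.
Hypothesis A_pos : forall s, a1 + beta - alpha <= s -> forall k,
  \sum_(0 <= i < k) dpow i s <= A * dpow k s.
Hypothesis A_neg : forall k, \sum_(0 <= i < k) dpow i (a1 - alpha) <= A.
Hypothesis A_q : forall k,
  \sum_(0 <= i < k) dpow i (a2 - mu - beta) <= A * dpow k (a2 - mu - beta).

Ltac index_lra := move: ha0 ha0mu hmua1 beta_gt0 halpha1 halpha2 ha2 h2alpha; lra.

Let TE k := SE (dyadic k).
Let TF k := SF (dyadic k).
Let q := a2 - mu.
Let B := (1 + D) * A.

Let mu0 : 0 <= mu. Proof. index_lra. Qed.
Let a10 : 0 <= a1. Proof. index_lra. Qed.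
Let a12 : a1 <= a2. Proof. index_lra. Qed.
Let mua2 : mu <= a2. Proof. index_lra. Qed.
Let a20 : 0 <= a2. Proof. index_lra. Qed.
Let q0 : 0 <= q. Proof. rewrite /q; index_lra. Qed.
Let D_ge0 : 0 <= D. Proof. exact: le_trans D_ge1. Qed.
Let A_ge0 : 0 <= A. Proof. exact: le_trans A_ge1. Qed.
Let AB : A <= B. Proof. by rewrite /B ler_peMl// lerDl. Qed.
Let DAB : D * A <= B. Proof. by rewrite /B ler_wpM2r// lerDr. Qed.
Let B_ge0 : 0 <= B. Proof. by apply: le_trans AB. Qed.
Let B_ge1 : 1 <= B. Proof. by apply: le_trans AB. Qed.

Context (g : F 0) (eps kappa : R).
Hypotheses (eps_gt0 : 0 < eps) (kappa_ge0 : 0 <= kappa).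
Hypothesis g_low : forall b, 0 <= b <= a2 + beta -> space_norm b (TF 0 g) <= eps.
Hypothesis g_diff : forall b k, 0 <= b <= a2 + beta ->
  space_norm b (TF k.+1 g - TF k g) <= eps * dpow k (b - beta).
Hypothesis g_lim : (fun k => TF k g) @ \oo --> g.
Hypotheses (kB3 : 3 * (kappa * B) <= 1) (kBr : kappa * B < r / 2) (kBd : kappa * B <= delta1).

(** The state consists of u_k and of the sum of the right-hand sides used
so far.  The increment of this sum is fed to Psi as it is, without division by
t_k: the bound on Psi is homogeneous, and Psi is not known to be linear. *)
Definition newton_step k (s : E a2 * F 0) : E a2 * F 0 :=
  let G' := TF k (g - (Phi (emb E mu a2 s.1) - Phi 0 - s.2)) in
  (s.1 + Psi (lift mu (TE k (emb E 0 a2 s.1))) (G' - s.2), G').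

Fixpoint newton k : E a2 * F 0 :=
  if k is k'.+1 then newton_step k' (newton k') else (0, 0).

Let un k := (newton k).1.
Let Gn k := (newton k).2.
Let u0 k := emb E 0 a2 (un k).
Let vn k : E mu := lift mu (TE k (u0 k)).
Let En k := Phi (emb E mu a2 (un k)) - Phi 0 - Gn k.
Let gam k := Gn k.+1 - Gn k.
Let hn k := Psi (vn k) (gam k).
Let Xn k := En k.+1 - En k.

Lemma un_S k : un k.+1 = un k + hn k. Proof. by []. Qed.
Lemma Gn_S k : Gn k.+1 = TF k (g - En k). Proof. by []. Qed.

Lemma un_sum k : un k = \sum_(0 <= i < k) hn i.
Proof.
by elim: k => [|k IH]; [rewrite big_nil | rewrite big_nat_recr//= un_S IH].
Qed.

Lemma En_0 : En 0 = 0.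
Proof. by rewrite /En /un /Gn /= linear0 subrr subr0. Qed.

Lemma En_sum k : En k = \sum_(0 <= i < k) Xn i.
Proof. by rewrite telescope_sumr// En_0 subr0. Qed.

Lemma TE_infty k u : in_infty (TE k u).
Proof. by case: hSE => _ h _; apply/h/dyadic_ge1. Qed.

Lemma TF_infty k u : in_infty (TF k u).
Proof. by case: hSF => _ h _; apply/h/dyadic_ge1. Qed.

Lemma TFD k u w : TF k (u + w) = TF k u + TF k w.
Proof.
case: hSF => h _ _; have := h _ (dyadic_ge1 k) 1 u w.
by rewrite !scale1r.
Qed.

Lemma TFB k u w : TF k (u - w) = TF k u - TF k w.
Proof.
case: hSF => h _ _; have := h _ (dyadic_ge1 k) (-1) w u.
by rewrite !scaleN1r => h'; rewrite /TF (addrC u) h' addrC.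
Qed.

Lemma Gn_infty k : in_infty (Gn k).
Proof.
case: k => [|k]; last exact: TF_infty.
by move=> a _; exact: in_space_zero.
Qed.

Lemma gam_infty k : in_infty (gam k).
Proof. by move=> a a0'; apply: in_spaceB; apply: Gn_infty. Qed.

Lemma emb_vn k : emb E 0 mu (vn k) = TE k (u0 k).
Proof. by rewrite /vn emb_lift//; exact: TE_infty. Qed.

Lemma u0_in k a : 0 <= a -> a <= a2 -> in_space a (u0 k).
Proof. by move=> a0' aa2; apply: (in_space_mono a0' aa2); exact: in_space_emb. Qed.

Lemma u0_norm k a : 0 <= a -> a <= a2 -> space_norm a (u0 k) = `|emb E a a2 (un k)|.
Proof. by move=> a0' aa2; rewrite -space_normE// emb_trans. Qed.

(** The invariant of the iteration.  It is kept for every a in [a1, a2], since the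
norm of v_k of exponent a + beta requires intermediate exponents of the previous
steps. *)
Definition step_bound k := forall a, a1 <= a -> a <= a2 ->
  `|emb E a a2 (hn k)| <= kappa * dpow k (a - alpha).

Definition steps_bounded k := forall i, (i < k)%N -> step_bound i.

Lemma un_le_sum k a : steps_bounded k -> a1 <= a -> a <= a2 ->
  `|emb E a a2 (un k)| <= kappa * \sum_(0 <= i < k) dpow i (a - alpha).
Proof.
move=> H a1a aa2; rewrite un_sum linear_sum.
apply: (le_trans (ler_norm_sum _ _ _)).
rewrite mulr_sumr big_nat [leRHS]big_nat; apply: ler_sum => i /andP[_ ik].
exact: H.
Qed.

(** From exponent a1 + beta on, a - alpha is bounded below by a positive number,
and the sum of the step bounds is of the size of its last term, with one constant
A. *)
Lemma un_high k a : steps_bounded k -> a1 + beta <= a -> a <= a2 ->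
  space_norm a (u0 k) <= kappa * A * dpow k (a - alpha).
Proof.
move=> H a1a aa2; rewrite u0_norm//; last index_lra.
apply: (le_trans (un_le_sum H _ aa2)); first index_lra.
by rewrite -mulrA ler_wpM2l//; apply: A_pos; index_lra.
Qed.

Lemma un_low k : steps_bounded k -> space_norm a1 (u0 k) <= kappa * A.
Proof.
move=> H; rewrite u0_norm//.
by apply: (le_trans (un_le_sum H (lexx _) a12)); rewrite ler_wpM2l.
Qed.

Lemma TE_same b k u : 0 <= b <= a2 + beta -> in_space b u ->
  space_norm b (TE k u) <= D * space_norm b u.
Proof.
by move=> bN ub; have [h _ _ _] := SE_le bN bN (dyadic_ge1 k) ub; exact: h.
Qed.

Lemma vn_low k : steps_bounded k -> space_norm a1 (TE k (u0 k)) <= kappa * B.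
Proof.
move=> H; apply: (le_trans (TE_same k _ (u0_in k a10 a12))); first by apply/andP; split; index_lra.
apply: (le_trans (ler_wpM2l D_ge0 (un_low H))).
by rewrite mulrCA ler_wpM2l.
Qed.

(** Above exponent a2 nothing is known on u_k, and the growth of the smoothing
operators takes over from a2. *)
Lemma vn_high k a : steps_bounded k -> a1 <= a -> a <= a2 ->
  space_norm (a + beta) (TE k (u0 k)) <= kappa * B * dpow k (a + beta - alpha).
Proof.
move=> H a1a aa2.
suff : space_norm (a + beta) (TE k (u0 k)) <= D * (kappa * A * dpow k (a + beta - alpha)).
  move=> /le_trans; apply; rewrite !mulrA ler_wpM2r ?dpow_ge0//.
  by rewrite -mulrA mulrCA -mulrA ler_wpM2l// mulrC.
have [ab|ab] := leP (a + beta) a2.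
  apply: (le_trans (TE_same k _ (u0_in k _ ab))); last 1 first.
  - by apply: ler_wpM2l => //; apply: un_high => //; index_lra.
  - by apply/andP; split; index_lra.
  - index_lra.
have a2N : 0 <= a2 <= a2 + beta by apply/andP; split; index_lra.
have abN : 0 <= a + beta <= a2 + beta by apply/andP; split; index_lra.
have [_ h _ _] := SE_le a2N abN (dyadic_ge1 k) (u0_in k a20 (lexx a2)).
apply: (le_trans (h (ltW ab))); rewrite -/(dpow k _).
have h2 := un_high H ha2 (lexx a2).
apply: (le_trans (ler_wpM2l _ h2)); first by rewrite mulr_ge0 ?dpow_ge0.
have -> : a + beta - alpha = (a + beta - a2) + (a2 - alpha) by ring.
rewrite [in leRHS]dpowD le_eqVlt; apply/orP; left; apply/eqP; ring.
Qed.

(** In E_a1, u_k itself is only bounded; the decay t_k^(a1 - alpha) of u_k - v_k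
comes from the norm of u_k in E_a2, smoothing from exponent a2 down to a1. *)
Lemma un_sub_vn_low k : steps_bounded k ->
  space_norm a1 (u0 k - TE k (u0 k)) <= kappa * B * dpow k (a1 - alpha).
Proof.
move=> H.
have a2N : 0 <= a2 <= a2 + beta by apply/andP; split; index_lra.
have a1N : 0 <= a1 <= a2 + beta by apply/andP; split; index_lra.
have a1a2 : a1 < a2 by index_lra.
have [_ _ h _] := SE_le a2N a1N (dyadic_ge1 k) (u0_in k a20 (lexx a2)).
apply: (le_trans (h a1a2)); rewrite -/(dpow k _).
apply: (le_trans (ler_wpM2l _ (un_high H ha2 (lexx a2)))).
  by rewrite mulr_ge0 ?dpow_ge0.
have -> : a1 - alpha = (a1 - a2) + (a2 - alpha) by ring.
rewrite dpowD.
have -> : D * dpow k (a1 - a2) * (kappa * A * dpow k (a2 - alpha)) =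
  kappa * (D * A) * (dpow k (a1 - a2) * dpow k (a2 - alpha)) by ring.
by rewrite ler_wpM2r ?mulr_ge0 ?dpow_ge0// ler_wpM2l.
Qed.

Lemma un_sub_vn_high k : steps_bounded k ->
  space_norm a2 (u0 k - TE k (u0 k)) <= kappa * B * dpow k (a2 - alpha).
Proof.
move=> H; have a2N : 0 <= a2 <= a2 + beta by apply/andP; split; index_lra.
have uin := u0_in k a20 (lexx a2).
apply: (le_trans (space_normB a20 uin _)); first exact: TE_infty.
have h := un_high H ha2 (lexx a2).
apply: (le_trans (lerD h (le_trans (TE_same k a2N uin) (ler_wpM2l D_ge0 h)))).
by rewrite le_eqVlt /B; apply/orP; left; apply/eqP; ring.
Qed.

Lemma vn_ok k : steps_bounded k ->
  [/\ `|emb E mu a2 (un k)| < r / 2, `|vn k| < r / 2, V (vn k),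
      in_infty (emb E 0 mu (vn k)) & space_norm a1 (emb E 0 mu (vn k)) <= delta1].
Proof.
move=> H.
have h1 : `|emb E mu a2 (un k)| < r / 2.
  rewrite -u0_norm//; apply: le_lt_trans kBr.
  apply: (le_trans (space_norm_mono mu0 hmua1 (u0_in k a10 a12))).
  by apply: (le_trans (un_low H)); rewrite ler_wpM2l.
have h2 : `|vn k| < r / 2.
  rewrite -space_normE// emb_vn; apply: le_lt_trans kBr.
  apply: (le_trans (space_norm_mono mu0 hmua1 _)); first exact: TE_infty.
  exact: vn_low.
split => //.
- by apply: ball_V; apply: (lt_le_trans h2); have := le_lt_trans (normr_ge0 _) h2; index_lra.
- by rewrite emb_vn; exact: TE_infty.
- by rewrite emb_vn; apply: le_trans kBd; exact: vn_low.
Qed.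

(** The increment of the accumulated error is the error of one Newton step, as
dPhi (v_k) h_k is exactly the increment of the sum of right-hand sides. *)
Lemma Xn_error k : steps_bounded k ->
  Xn k = Phi (emb E mu a2 (un k + hn k)) - Phi (emb E mu a2 (un k))
         - dPhi (vn k) (emb E mu a2 (hn k)).
Proof.
move=> H; have [_ _ Vv vi vd] := vn_ok H.
rewrite Psi_inv//; last exact: gam_infty.
by rewrite /Xn /En un_S sub_diffs.
Qed.

Let eta := 6 * C1 * (kappa * B) ^+ 2.

Let eta_ge0 : 0 <= eta. Proof. by apply: mulr_ge0; [exact: mulr_ge0 | exact/exprn_ge0/mulr_ge0]. Qed.

Lemma hn_ok k : step_bound k -> `|emb E mu a2 (hn k)| < r / 2.
Proof.
move=> H; apply: le_lt_trans kBr.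
rewrite -(emb_trans (b0 := E) mu0 hmua1 a12).
apply: (le_trans (emb_norm_le mu0 hmua1 _)).
apply: (le_trans (H _ (lexx _) a12)); rewrite ler_wpM2l//.
by apply: le_trans B_ge1; apply: dpow_le1; index_lra.
Qed.

(** All increments are measured in E_a1, and 2 (a1 - alpha) <= - beta. *)
Lemma Xn_low k : steps_bounded k -> step_bound k ->
  `|Xn k| <= eta * dpow k (- beta).
Proof.
move=> H Hk; have [ur vr _ _ _] := vn_ok H; have hr := hn_ok Hk.
have q00 : 0 <= a2 - mu by exact: q0.
have E0mu (x : E mu) : emb E mu mu x = x by exact: emb_refl.
have a0a2 : a0 <= a2 by index_lra.
have a0a1 : a0 <= a1 by index_lra.
pose P := kappa * B * dpow k (a1 - alpha).
have uvP : `|emb E mu a2 (un k) - vn k| <= P.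
  rewrite -space_normE// linearB/= emb_vn emb_trans//.
  apply: (le_trans (space_norm_mono mu0 hmua1 _)); last exact: un_sub_vn_low.
  by apply: in_spaceB; [exact: u0_in | exact: TE_infty].
have hP1 : `|emb E a1 a2 (hn k)| <= P.
  apply: (le_trans (Hk _ (lexx _) a12)); rewrite ler_wpM2r ?dpow_ge0//.
  by rewrite ler_peMr.
have hP : `|emb E mu a2 (hn k)| <= P.
  apply: le_trans hP1.
  rewrite -(emb_trans (b0 := E) mu0 hmua1 a12); exact: emb_norm_le.
have a0le (x : E mu) : `|x| <= P -> `|emb E a0 mu x| <= P.
  by apply: le_trans; exact: emb_norm_le.
have kP : P <= kappa * B.
  have : dpow k (a1 - alpha) <= 1 by apply: dpow_le1; index_lra.
  exact: ler_piMr (mulr_ge0 kappa_ge0 B_ge0).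
have W1 : `|emb E mu a2 (un k)| + `|vn k| + `|emb E mu a2 (hn k)| <= 1.
  apply: le_trans kB3.
  have h1 : `|emb E mu a2 (un k)| <= kappa * B.
    rewrite -u0_norm//.
    apply: (le_trans (space_norm_mono mu0 hmua1 (u0_in k a10 a12))).
    by apply: (le_trans (un_low H)); rewrite ler_wpM2l.
  have h2 : `|vn k| <= kappa * B.
    rewrite -space_normE// emb_vn.
    apply: (le_trans (space_norm_mono mu0 hmua1 _)); first exact: TE_infty.
    exact: vn_low.
  have -> : 3 * (kappa * B) = kappa * B + kappa * B + kappa * B by ring.
  by rewrite !lerD// (le_trans hP).
have mu0E : mu = 0 + mu by rewrite add0r.
have := @level_newton_error R E F mu a0 V Phi dPhi d2Phi mu 0 C1 r (lexx 0) C1_ge0 ball_V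
  (Phi_C2 mu0E (lexx 0) q00) (d2Phi_le mu0E (lexx 0) q00)
  (emb E mu a2 (un k)) (vn k) (emb E mu a2 (hn k)) P P 1.
rewrite !E0mu => /(_ ur vr hr uvP hP (a0le _ uvP) (a0le _ hP) W1).
rewrite -linearD -Xn_error// => -[_]; rewrite space_norm0 => /le_trans; apply.
have -> : 2 * C1 * (2 * P * P + 1 * P ^+ 2) = 6 * C1 * P ^+ 2 by ring.
rewrite /eta -[leRHS]mulrA; apply: ler_wpM2l; first exact: mulr_ge0.
rewrite /P exprMn; apply: ler_wpM2l; first exact/exprn_ge0/mulr_ge0.
by rewrite expr2 -dpowD; apply: dpow_le; index_lra.
Qed.

(** One factor is measured in E_a2 and the other in E_a1; the resulting
exponent a1 + a2 - 2 alpha is at most a2 - mu - beta since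
2 alpha >= 2 a1 + beta >= a1 + mu + beta. *)
Lemma Xn_high k : steps_bounded k -> step_bound k ->
  in_space q (Xn k) /\ space_norm q (Xn k) <= eta * dpow k (q - beta).
Proof.
move=> H Hk; have [ur vr _ _ _] := vn_ok H; have hr := hn_ok Hk.
have q00 : 0 <= a2 - mu by exact: q0.
have a0a2 : a0 <= a2 by index_lra.
have a0a1 : a0 <= a1 by index_lra.
pose P := kappa * B * dpow k (a2 - alpha).
pose Q := kappa * B * dpow k (a1 - alpha).
pose v2 : E a2 := lift a2 (TE k (u0 k)).
have v2E : emb E 0 a2 v2 = TE k (u0 k) by rewrite emb_lift//; exact: TE_infty.
have v2mu : emb E mu a2 v2 = vn k.
  apply: (emb_injective (b0 := E) (lexx 0) mu0).
  by rewrite emb_trans// v2E emb_vn.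
have uv0 : emb E 0 a2 (un k - v2) = u0 k - TE k (u0 k) by rewrite linearB/= v2E.
have uvP : `|un k - v2| <= P.
  by rewrite -space_normE// uv0; exact: un_sub_vn_high.
have hP : `|hn k| <= P.
  have := Hk a2 a12 (lexx a2); rewrite emb_refl// => /le_trans; apply.
  by rewrite ler_wpM2r ?dpow_ge0// ler_peMr.
have toa0 (x : E a2) : `|emb E a1 a2 x| <= Q -> `|emb E a0 a2 x| <= Q.
  by apply: le_trans; rewrite -(emb_trans (b0 := E) ha0 a0a1 a12); exact: emb_norm_le.
have uvQ : `|emb E a0 a2 (un k - v2)| <= Q.
  by apply: toa0; rewrite -space_normE// emb_trans// uv0; exact: un_sub_vn_low.
have hQ : `|emb E a0 a2 (hn k)| <= Q.
  apply: toa0; apply: (le_trans (Hk _ (lexx _) a12)).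
  by rewrite ler_wpM2r ?dpow_ge0// ler_peMr.
have W1 : `|un k| + `|v2| + `|hn k| <= dpow k (a2 - alpha).
  apply: (@le_trans _ _ (P + P + P)); last first.
    have -> : P + P + P = 3 * (kappa * B) * dpow k (a2 - alpha) by rewrite /P; ring.
    by rewrite ler_piMl ?dpow_ge0.
  have h1 : space_norm a2 (u0 k) <= kappa * A * dpow k (a2 - alpha).
    exact: un_high.
  rewrite !lerD//.
    rewrite -space_normE//; apply: (le_trans h1).
    by rewrite ler_wpM2r ?dpow_ge0// ler_wpM2l.
  rewrite -space_normE// v2E.
  apply: (le_trans (TE_same k _ (u0_in k a20 (lexx a2)))).
    by apply/andP; split; index_lra.
  apply: (le_trans (ler_wpM2l D_ge0 h1)).
  by rewrite mulrA ler_wpM2r ?dpow_ge0// mulrCA ler_wpM2l.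
have a2E : a2 = a2 - mu + mu by rewrite subrK.
rewrite -v2mu in vr.
have [Xq] := @level_newton_error R E F mu a0 V Phi dPhi d2Phi a2 (a2 - mu) C1 r q00 C1_ge0 ball_V
  (Phi_C2 a2E q00 (lexx _)) (d2Phi_le a2E q00 (lexx _))
  (un k) v2 (hn k) P Q (dpow k (a2 - alpha)) ur vr hr uvP hP uvQ hQ W1.
rewrite v2mu -Xn_error// in Xq *.
move=> XP; split=> //; apply: (le_trans XP).
have PQ : P * Q = (kappa * B) ^+ 2 * dpow k (a2 + a1 - 2 * alpha).
  have -> : a2 + a1 - 2 * alpha = (a2 - alpha) + (a1 - alpha) by ring.
  by rewrite /P /Q (dpowD k (a2 - alpha)); ring.
have WQ : dpow k (a2 - alpha) * Q ^+ 2 <= (kappa * B) ^+ 2 * dpow k (a2 + a1 - 2 * alpha).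
  have -> : dpow k (a2 - alpha) * Q ^+ 2 = (kappa * B) ^+ 2 *
      (dpow k (a2 - alpha) * (dpow k (a1 - alpha) * dpow k (a1 - alpha))).
    by rewrite /Q; ring.
  apply: ler_wpM2l; first exact/exprn_ge0/mulr_ge0.
  by rewrite -!dpowD; apply: dpow_le; index_lra.
apply: (@le_trans _ _ (eta * dpow k (a2 + a1 - 2 * alpha))); last first.
  by rewrite ler_wpM2l//; apply: dpow_le; rewrite /q; index_lra.
have -> : eta * dpow k (a2 + a1 - 2 * alpha) =
    2 * C1 * (2 * ((kappa * B) ^+ 2 * dpow k (a2 + a1 - 2 * alpha))
              + (kappa * B) ^+ 2 * dpow k (a2 + a1 - 2 * alpha)).
  by rewrite /eta; ring.
by rewrite ler_wpM2l ?mulr_ge0// lerD// -mulrA PQ.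
Qed.

Lemma En_high k : steps_bounded k ->
  in_space q (En k) /\ space_norm q (En k) <= A * eta * dpow k (q - beta).
Proof.
move=> H; have Hi i : (i < k)%N -> in_space q (Xn i) /\ space_norm q (Xn i) <= eta * dpow i (q - beta).
  by move=> ik; apply: Xn_high; [move=> j ji; apply: H; exact: ltn_trans ik | exact: H].
rewrite En_sum; split; first by apply: in_space_sum => i /Hi[].
apply: (le_trans (space_norm_sum q0 (fun i ik => proj1 (Hi i ik)))).
apply: (@le_trans _ _ (\sum_(0 <= i < k) eta * dpow i (q - beta))).
  by rewrite big_nat [leRHS]big_nat; apply: ler_sum => i /andP[_ /Hi[]].
rewrite -mulr_sumr -mulrA mulrCA; apply: ler_wpM2l => //; exact: A_q.
Qed.

Let D2 := 2 `^ beta * (D * (A + 1)).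

(** For k = m + 1, gamma_k is the sum of (T_k - T_m) (g - E_m) and
- T_k (E_k - E_m).  The bound on E_m at the single exponent q suffices for the
first term, and the bound on E_k - E_m in F_0 for the second.  This last term
belongs to the scale of step m but counts for step k, which costs the factor
2^beta only because the sequence is dyadic. *)
Lemma gam_le k b : steps_bounded k -> 0 <= b <= a2 + beta ->
  space_norm b (gam k) <= D2 * (eps + eta) * dpow k (b - beta).
Proof.
move=> H /[dup] bN /andP[b0 _].
have two1 : 1 <= 2 `^ beta :> R by rewrite -[leLHS](powRr0 2); apply: ler_powR; rewrite ?ler1n// ltW.
have DA1 : 1 <= D * (A + 1).
  by apply: mulr_ege1 => //; rewrite lerDr.
have D21 : 1 <= D2 by exact: mulr_ege1.
case: k H => [|m] H.
  rewrite dpow0 mulr1 /gam Gn_S En_0 !subr0.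
  apply: (le_trans (g_low bN)); rewrite -[eps]mul1r ler_pM ?(ltW eps_gt0)//.
  by rewrite mul1r lerDl.
have Hm : steps_bounded m by move=> i im; apply: H; exact: ltn_trans im _.
have Hm1 : step_bound m by exact: H.
have [Eq EB] := En_high Hm.
have [Xq _] := Xn_high Hm Hm1.
have XB := Xn_low Hm Hm1.
have qN : 0 <= q <= a2 + beta by apply/andP; split; rewrite /q; index_lra.
have z0N : 0 <= (0:R) <= a2 + beta by apply/andP; split; index_lra.
have -> : gam m.+1 = (TF m.+1 g - TF m g) - (TF m.+1 (En m) - TF m (En m)) - TF m.+1 (Xn m).
  have EX : TF m.+1 (En m.+1) = TF m.+1 (En m) + TF m.+1 (Xn m).
    by rewrite -TFD /Xn addrC subrK.
  by rewrite /gam !Gn_S (TFB m.+1 g (En m.+1)) (TFB m g (En m)) EX sub_increments.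
have TFin n w : in_space b (TF n w) by exact: TF_infty.
have i1 : in_space b (TF m.+1 g - TF m g) by exact: in_spaceB.
have i2 : in_space b (TF m.+1 (En m) - TF m (En m)) by exact: in_spaceB.
apply: (le_trans (space_normB b0 (in_spaceB i1 i2) (TFin _ _))).
apply: (le_trans (lerD (space_normB b0 i1 i2) (lexx _))).
have e1 := g_diff m bN.
have e2 : space_norm b (TF m.+1 (En m) - TF m (En m)) <= D * (A * eta) * dpow m (b - beta).
  have [_ _ _ h] := SF_le qN bN (dyadic_ge1 m) Eq.
  have dm0 : 0 <= dyadic m :> R by exact/ltW/dyadic_gt0.
  have d1 : dyadic m <= dyadic m.+1 :> R by rewrite -subr_ge0 dyadic_gap.
  have d2 : dyadic m.+1 <= 2 * dyadic m :> R by rewrite /dyadic exprS.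
  apply: (le_trans (h _ d1 d2)); rewrite dyadic_gap -/(dpow m _) dyadic_dpow.
  apply: (le_trans (ler_wpM2l _ EB)); first by apply: mulr_ge0 => //; exact: dpow_ge0.
  have -> : b - beta = (b - q) + (q - beta) by ring.
  by rewrite [in leRHS]dpowD le_eqVlt; apply/orP; left; apply/eqP; ring.
have e3 : space_norm b (TF m.+1 (Xn m)) <= D * eta * 2 `^ beta * dpow m.+1 (b - beta).
  have X0 : in_space 0 (Xn m) by exists (Xn m) => //; exact: emb0.
  have [_ h _ _] := SF_le z0N bN (dyadic_ge1 m.+1) X0.
  apply: (le_trans (h b0)); rewrite subr0 space_norm0 -/(dpow m.+1 _).
  apply: (le_trans (ler_wpM2l _ XB)); first by apply: mulr_ge0 => //; exact: dpow_ge0.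
  rewrite (dpowD m.+1 b) (dpowS m (- beta)).
  have -> : D * eta * 2 `^ beta * (dpow m.+1 b * (2 `^ (- beta) * dpow m (- beta))) =
     D * eta * (2 `^ beta * 2 `^ (- beta)) * dpow m.+1 b * dpow m (- beta) by ring.
  rewrite -powRD ?pnatr_eq0 ?implybT// subrr powRr0 mulr1.
  by rewrite le_eqVlt; apply/orP; left; apply/eqP; ring.
have tm : dpow m (b - beta) <= 2 `^ beta * dpow m.+1 (b - beta).
  rewrite dpowS mulrA -powRD ?pnatr_eq0 ?implybT// addrCA subrr addr0.
  rewrite ler_peMl ?dpow_ge0// -[leLHS](powRr0 2).
  by apply: ler_powR => //; rewrite ler1n.
apply: (le_trans (lerD (lerD e1 e2) e3)).
have p0 := dpow_ge0 m.+1 (b - beta).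
have c0 : 0 <= eps + D * (A * eta).
  by apply: addr_ge0; [exact: ltW | apply: mulr_ge0 => //; exact: mulr_ge0].
rewrite -mulrDl; apply: (le_trans (lerD (ler_wpM2l c0 tm) (lexx _))).
have -> : (eps + D * (A * eta)) * (2 `^ beta * dpow m.+1 (b - beta)) +
  D * eta * 2 `^ beta * dpow m.+1 (b - beta) =
  2 `^ beta * (eps + D * (A + 1) * eta) * dpow m.+1 (b - beta) by ring.
apply: ler_wpM2r => //; rewrite /D2 -[leRHS]mulrA; apply: ler_wpM2l; first exact: powR_ge0.
by rewrite [leRHS]mulrDr lerD2r ler_peMl// ltW.
Qed.

Hypothesis kappa_fix : 2 * C2 * D2 * (eps + eta) <= kappa.

(** The right inverse sends the bounds on gamma_k to those on h_k; the factor
kappa B <= 1 makes the term with |v_k| no worse than the other one, hence the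
factor 2. *)
Lemma hn_le k : steps_bounded k -> step_bound k.
Proof.
move=> H a a1a aa2.
have [_ _ Vv vi vd] := vn_ok H.
have K2 : 0 <= C2 * (D2 * (eps + eta)).
  apply: mulr_ge0 => //; apply: mulr_ge0.
    by apply: mulr_ge0; [exact: powR_ge0 | apply: mulr_ge0 => //; exact: addr_ge0].
  by apply: addr_ge0 => //; exact: ltW.
have b1N : 0 <= a + beta - alpha <= a2 + beta by apply/andP; split; index_lra.
have z0N : 0 <= (0:R) <= a2 + beta by apply/andP; split; index_lra.
have g1 := gam_le H b1N; have g0 := gam_le H z0N.
rewrite space_norm0 sub0r in g0.
have v1 := vn_high H a1a aa2.
apply: (le_trans (Psi_le Vv vi vd (gam_infty k) a1a aa2)).
rewrite emb_vn.
apply: (@le_trans _ _ (C2 * (D2 * (eps + eta) * dpow k (a - alpha)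
   + D2 * (eps + eta) * dpow k (a - alpha)))); last first.
  have -> : C2 * (D2 * (eps + eta) * dpow k (a - alpha) + D2 * (eps + eta) * dpow k (a - alpha))
    = 2 * C2 * D2 * (eps + eta) * dpow k (a - alpha) by ring.
  by apply: ler_wpM2r => //; exact: dpow_ge0.
apply: ler_wpM2l => //; apply: lerD.
  by apply: (le_trans g1); rewrite (_ : a + beta - alpha - beta = a - alpha)//; ring.
apply: (le_trans (ler_pM (normr_ge0 _) (space_norm_ge0 _ _) g0 v1)).
have -> : a - alpha = - beta + (a + beta - alpha) by ring.
rewrite (dpowD k (- beta)).
have -> : D2 * (eps + eta) * dpow k (- beta) * (kappa * B * dpow k (a + beta - alpha)) =
   (kappa * B) * (D2 * (eps + eta) * (dpow k (- beta) * dpow k (a + beta - alpha))) by ring.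
rewrite ler_piMl//.
  apply: mulr_ge0; last by apply: mulr_ge0; exact: dpow_ge0.
  apply: mulr_ge0; last by apply: addr_ge0 => //; exact: ltW.
  by apply: mulr_ge0; [exact: powR_ge0 | apply: mulr_ge0 => //; exact: addr_ge0].
have := kB3; have : 0 <= kappa * B by exact: mulr_ge0.
lra.
Qed.

Lemma all_steps_bounded k : steps_bounded k.
Proof.
elim: k => // k IH i; rewrite ltnS leq_eqVlt => /orP[/eqP ->|]; last exact: IH.
exact: hn_le.
Qed.

Lemma all_step_bound k : step_bound k.
Proof. exact/hn_le/all_steps_bounded. Qed.

(** By the choice of gamma_k, the sum G of the right-hand sides cancels. *)
Lemma Phi_un k : Phi (emb E mu a2 (un k.+1)) =
  Phi 0 + (TF k g + (En k - TF k (En k)) + Xn k).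
Proof.
have -> : Phi (emb E mu a2 (un k.+1)) = Phi 0 + (Gn k.+1 + En k.+1).
  by rewrite /En [Gn _ + _]addrC subrK addrC subrK.
have -> : En k.+1 = En k + Xn k by rewrite /Xn addrC subrK.
rewrite Gn_S (TFB k g (En k)); congr (_ + _).
by rewrite addrA -[_ - _ + _]addrA [- _ + _]addrC.
Qed.

Lemma Phi_un_cvg : (fun k => Phi (emb E mu a2 (un k))) @ \oo --> Phi 0 + g.
Proof.
rewrite -cvg_shiftS /=; under eq_fun do rewrite Phi_un.
apply: cvgD; first exact: cvg_cst.
rewrite -[X in _ --> X]addr0; apply: cvgD; last first.
  apply: (@dpow_squeeze0 _ _ _ eta (- beta)); first by rewrite oppr_lt0.
  by move=> k; exact: Xn_low (@all_steps_bounded k) (@all_step_bound k).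
rewrite -[X in _ --> X]addr0; apply: cvgD; first exact: g_lim.
apply: (@dpow_squeeze0 _ _ _ (D * (A * eta)) (- beta)); first by rewrite oppr_lt0.
move=> k; have [Eq EB] := En_high (@all_steps_bounded k).
have qN : 0 <= q <= a2 + beta by apply/andP; split; rewrite /q; index_lra.
have z0N : 0 <= (0:R) <= a2 + beta by apply/andP; split; index_lra.
have q_gt0 : 0 < q by rewrite /q; index_lra.
have [_ _ /(_ q_gt0) h _] := SF_le qN z0N (dyadic_ge1 k) Eq.
rewrite -space_norm0; apply: (le_trans h); rewrite -/(dpow k _).
apply: (le_trans (ler_wpM2l _ EB)); first by apply: mulr_ge0 => //; exact: dpow_ge0.
have -> : dpow k (- beta) = dpow k (0 - q) * dpow k (q - beta).
  by rewrite -dpowD; congr (dpow _ _); ring.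
by rewrite le_eqVlt; apply/orP; left; apply/eqP; ring.
Qed.

Lemma newton_solution : exists u : E mu,
  [/\ V u, Phi u = Phi 0 + g &
      exists x : nat -> E a2, weak_decomp dyadic a1 alpha (emb E 0 mu u) x kappa].
Proof.
have hB k a : a1 <= a -> a <= a2 ->
    `|emb E a a2 (hn k)| <= kappa * dpow k (a - alpha).
  exact: (@all_step_bound k a).
have al1 : a1 - alpha < 0 by index_lra.
have ua b n : emb E b a2 (un n) = series (fun i => emb E b a2 (hn i)) n.
  by rewrite un_sum linear_sum.
have un1 : cvgn (series (fun i => emb E a1 a2 (hn i))).
  apply: (abs_cvg_series (r := fun i => kappa * dpow i (a1 - alpha)) (B := kappa * A)).
    by move=> i; exact: hB.
  by move=> n; rewrite -mulr_sumr ler_wpM2l.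
set y1 := limn (series (fun i => emb E a1 a2 (hn i))) in un1.
have uny1 : (fun n => emb E a1 a2 (un n)) @ \oo --> y1.
  by under eq_fun do rewrite ua.
have umu : (fun n => emb E mu a2 (un n)) @ \oo --> emb E mu a1 y1.
  under eq_fun do rewrite -(emb_trans (b0 := E) mu0 hmua1 a12).
  exact: emb_cvg.
have u0y : (fun n => u0 n) @ \oo --> emb E 0 a1 y1.
  rewrite /u0; under eq_fun do rewrite -(emb_trans (b0 := E) (lexx 0) a10 a12).
  exact: emb_cvg.
have rB : 0 < r / 2 by apply: le_lt_trans kBr; exact: mulr_ge0.
have unV n : V (emb E mu a2 (un n)).
  have [h _ _ _ _] := vn_ok (@all_steps_bounded n).
  by apply: ball_V; apply: (lt_trans h); move: rB; lra.
have uV : V (emb E mu a1 y1).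
  apply: ball_V; apply: (@le_lt_trans _ _ (r / 2)); last by move: rB; lra.
  apply: (cvg_norm_le umu) => n.
  by have [/ltW] := vn_ok (@all_steps_bounded n).
exists (emb E mu a1 y1); split => //.
  have E0mu (x : E mu) : emb E mu mu x = x by exact: emb_refl.
  have q00 : 0 <= a2 - mu by exact: q0.
  have := Phi_cvg (Phi_C2 (c := mu) (esym (add0r mu)) (lexx 0) q00)
    (x := fun n => emb E mu a2 (un n)) (y := emb E mu a1 y1).
  have -> : (fun n => Phi (emb E mu mu (emb E mu a2 (un n)))) =
    fun n => Phi (emb E mu a2 (un n)) by apply/funext => n; rewrite E0mu.
  rewrite !E0mu => h; have {}h := h _ uV umu.
  apply: (cvg_unique _ _ Phi_un_cvg); first exact: norm_hausdorff.
  by apply: h => n; rewrite E0mu.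
rewrite emb_trans//.
have dp k : 0 < dyadic k :> R by exact: dyadic_gt0.
exists (fun j => (dyadic j)^-1 *: hn j); split.
  (* below a1 the step bounds are not available, and convergence is inherited from E_a1 *)
  move=> b b0 ba; pose b' := Num.max b a1.
  have bb' : b <= b' by rewrite le_max lexx.
  have a1b' : a1 <= b' by rewrite le_max lexx orbT.
  have b'a : b' < alpha by rewrite gt_max ba/=; index_lra.
  have b'a2 : b' <= a2 by move: b'a; index_lra.
  have b'0 : 0 <= b' := le_trans b0 bb'.
  have bal : b' - alpha < 0 by rewrite subr_lt0.
  have [A' A'0 HA'] := dpow_sum_neg bal.
  have [y yE yl] := @abs_cvg_in_space _ E b' (fun i => emb E b' a2 (hn i))
    (fun i => kappa * dpow i (b' - alpha)) (kappa * A') (emb E 0 a1 y1) b'0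
    (fun i => hB i b' a1b' b'a2)
    ltac:(by move=> n; rewrite -mulr_sumr ler_wpM2l)
    ltac:(by under [X in series X]eq_fun do rewrite emb_trans//;
             move: u0y; rewrite /u0; under eq_fun do rewrite ua).
  exists (emb E b b' y); first by rewrite emb_trans.
  have -> : series (fun j => (dyadic j.+1 - dyadic j) *: emb E b a2 ((dyadic j)^-1 *: hn j)) =
      fun n => emb E b b' (series (fun i => emb E b' a2 (hn i)) n).
    apply/funext => n; rewrite /series/= linear_sum; apply: eq_bigr => i _.
    by rewrite emb_trans// dyadic_gap linearZ/= scalerA divff ?scale1r// gt_eqF.
  exact: emb_cvg.
have xB j a : a1 <= a -> a <= a2 ->
    `|emb E a a2 ((dyadic j)^-1 *: hn j)| <= kappa * dpow j (a - alpha - 1).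
  move=> a1a aa2; rewrite linearZ normrZ gtr0_norm ?invr_gt0// ler_pdivrMl//.
  by rewrite mulrCA dyadic_dpow hB.
move=> j; split; first exact: xB.
by rewrite -[X in `|X|](emb_refl a20); exact: xB.
Qed.

End Iteration.

(** * The implicit function theorem *)

Lemma smoothing_estimatesW (R : realType) (E : banach_scale R) (S : R -> E 0 -> E 0)
    (N K C C' : R) :
  C <= C' -> smoothing_estimates S N K C -> smoothing_estimates S N K C'.
Proof.
move=> CC' H a b s u aN bN s1 ua.
have [h1 h2 h3 h4] := H a b s u aN bN s1 ua.
split.
- by move=> /h1 /le_trans; apply; rewrite ler_wpM2r ?space_norm_ge0.
- by move=> /h2 /le_trans; apply; rewrite !ler_wpM2r ?space_norm_ge0 ?powR_ge0.
- by move=> /h3 /le_trans; apply; rewrite !ler_wpM2r ?space_norm_ge0 ?powR_ge0.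
- move=> s' ss' s'K; apply: (le_trans (h4 s' ss' s'K)).
  by rewrite !ler_wpM2r ?space_norm_ge0 ?mulr_ge0 ?subr_ge0 ?powR_ge0.
Qed.

(** The error is quadratic in the size e of the data, so that c (L e)^2 <= e for
small e. *)
Lemma small_exists (R : realType) (L c r d : R) : 0 <= L -> 0 <= c -> 0 < r -> 0 < d ->
  exists2 e0, 0 < e0 & forall e, 0 < e -> e <= e0 ->
    [/\ 3 * (L * e) <= 1, L * e < r / 2, L * e <= d & c * (L * e) ^+ 2 <= e].
Proof.
move=> L0 c0 r0 d0.
pose m := Num.min (1 / 3) (Num.min (r / 4) d).
have m0 : 0 < m by rewrite !lt_min d0 !divr_gt0.
have m3 : m <= 1 / 3 by rewrite ge_min lexx.
have mr : m <= r / 4 by rewrite !ge_min lexx orbT.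
have md : m <= d by rewrite !ge_min lexx !orbT.
have L1 : 0 < L + 1 by rewrite ltr_wpDl.
have cL0 : 0 <= c * L ^+ 2 by rewrite mulr_ge0// exprn_ge0.
have cL1 : 0 < c * L ^+ 2 + 1 by rewrite ltr_wpDl.
exists (Num.min (m / (L + 1)) (c * L ^+ 2 + 1)^-1).
  by rewrite lt_min divr_gt0// invr_gt0.
move=> e e0; rewrite le_min => /andP[]; rewrite ler_pdivlMr// => h1.
rewrite -[leRHS]mul1r ler_pdivlMr// => h2.
have Lm : L * e <= m by apply: le_trans h1; rewrite mulrDr mulr1 mulrC lerDl ltW.
split; [lra | lra | lra |].
have -> : c * (L * e) ^+ 2 = e * (c * L ^+ 2 * e) by ring.
rewrite ler_piMr ?(ltW e0)//; apply: le_trans h2.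
by rewrite mulrDr mulr1 [e * _]mulrC lerDl ltW.
Qed.

Lemma weak_decomp_zero (R : realType) (E : banach_scale R) (theta : nat -> R)
    (b1 b2 a : R) : weak_decomp theta b1 a (0 : E 0) (fun=> 0 : E b2) 0.
Proof.
split; last by move=> j; rewrite linear0 !normr0 !mul0r.
move=> b b0 ba; exists 0; first by rewrite linear0.
rewrite (_ : series _ = fun=> 0); first exact: cvg_cst.
by apply/funext => n; rewrite /series/= big1// => i _; rewrite linear0 scaler0.
Qed.

Lemma weak_norm_le (R : realType) (E : banach_scale R) (theta : nat -> R)
    (b1 b2 a : R) (u : E 0) (x : nat -> E b2) (M : R) : admissible_seq theta ->
  weak_decomp theta b1 a u x M -> weak_norm theta b1 b2 a u <= M.
Proof.
move=> H ux; apply: ge_inf; last by exists x.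
by exists 0 => M' [x' /(weak_decomp_ge0 H)].
Qed.

Theorem theorem7p1 (R : realType) (E F : banach_scale R)
    (SE : R -> E 0 -> E 0) (hSE : smoothing SE)
    (SF : R -> F 0 -> F 0) (hSF : smoothing SF)
    (theta : nat -> R) (htheta : admissible_seq theta)
    (a1 a2 alpha beta a0 mu : R)
    (ha0 : 0 <= a0) (ha0mu : a0 <= mu) (hmua1 : mu <= a1)
    (halpha1 : a1 + beta / 2 <= alpha) (halpha2 : alpha < a1 + beta)
    (ha2 : a1 + beta <= a2) (h2alpha : 2 * alpha < a1 + a2)
    (* auxiliary exponents defining E'_alpha and F'_beta *)
    (b1 b2 : R) (hb1 : 0 <= b1) (hb1a : b1 < alpha) (hb2 : alpha < b2)
    (c1 c2 : R) (hc1 : 0 <= c1) (hc1b : c1 < beta) (hc2 : beta < c2)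
    (V : set (E mu)) (hVconv : convex_set V) (hV0 : nbhs (0 : E mu) V)
    (Phi : E mu -> F 0)
    (dPhi : E mu -> E mu -> F 0) (d2Phi : E mu -> E mu -> E mu -> F 0)
    (hC2 : forall a : R, 0 <= a -> a <= a2 - mu ->
       C2_level V Phi dPhi d2Phi (a + mu) a)
    (C1 : R)
    (hd2Phi : forall a : R, 0 <= a -> a <= a2 - mu ->
       forall u v w : E (a + mu), V (emb E mu (a + mu) u) ->
       space_norm a (d2Phi (emb E mu (a + mu) u) (emb E mu (a + mu) v)
                           (emb E mu (a + mu) w))
       <= C1 * (`|v| * `|emb E a0 (a + mu) w|
                + `|emb E a0 (a + mu) v| * `|w|
                + `|u| * `|emb E a0 (a + mu) v| * `|emb E a0 (a + mu) w|))
    (delta1 : R) (hdelta1 : 0 < delta1)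
    (Psi : E mu -> F 0 -> E a2)
    (hPsi_inv : forall (v : E mu) (g : F 0),
       V v -> in_infty (emb E 0 mu v) ->
       space_norm a1 (emb E 0 mu v) <= delta1 -> in_infty g ->
       dPhi v (emb E mu a2 (Psi v g)) = g)
    (C2 : R)
    (hPsi_bound : forall (v : E mu) (g : F 0),
       V v -> in_infty (emb E 0 mu v) ->
       space_norm a1 (emb E 0 mu v) <= delta1 -> in_infty g ->
       forall a : R, a1 <= a -> a <= a2 ->
       `|emb E a a2 (Psi v g)|
       <= C2 * (space_norm (a + beta - alpha) g
                + `|g| * space_norm (a + beta) (emb E 0 mu v))) :
  exists delta : R, 0 < delta /\ exists C : R,
    forall g : F 0, weak_space theta c1 c2 beta g ->
      weak_norm theta c1 c2 beta g <= delta ->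
      exists u : E mu,
        [/\ V u,
            weak_space theta b1 b2 alpha (emb E 0 mu u),
            weak_norm theta b1 b2 alpha (emb E 0 mu u)
              <= C * weak_norm theta c1 c2 beta g &
            Phi u = Phi 0 + g].
Proof.
have beta_gt0 : 0 < beta by lra.
have [r r0 ball_V] : exists2 r, 0 < r & forall x : E mu, `|x| < r -> V x.
  move: hV0 => /nbhs_ballP[r /= r0 rV]; exists r => // x xr; apply: rV.
  by rewrite -ball_normE/= sub0r normrN.
have V0 : V 0 by apply: ball_V; rewrite normr0.
pose C1' := Num.max C1 0.
have C1'0 : 0 <= C1' by rewrite le_max lexx orbT.
have C1C1' : C1 <= C1' by rewrite le_max lexx.
pose C2' := Num.max C2 0.
have C2'0 : 0 <= C2' by rewrite le_max lexx orbT.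
have C2C2' : C2 <= C2' by rewrite le_max lexx.
have N0 : 0 <= a2 + beta by lra.
have two1 : 1 <= 2 :> R by rewrite ler1n.
have [DE DE1 SE_le] := smoothing_estimatesP hSE N0 two1.
have [DF DF1 SF_le] := smoothing_estimatesP hSF N0 two1.
pose D := Num.max DE DF.
have D1 : 1 <= D by rewrite le_max DE1.
have {}SE_le : smoothing_estimates SE (a2 + beta) 2 D.
  by apply: smoothing_estimatesW SE_le; rewrite le_max lexx.
have {}SF_le : smoothing_estimates SF (a2 + beta) 2 D.
  by apply: smoothing_estimatesW SF_le; rewrite le_max lexx orbT.
have [A1 _ HA1] := @dpow_sum_pos R (a1 + beta - alpha) ltac:(lra).
have [A2 _ HA2] := @dpow_sum_neg R (a1 - alpha) ltac:(lra).
have [A3 _ HA3] := @dpow_sum_pos R (a2 - mu - beta) ltac:(lra).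
pose A := Num.max (Num.max A1 A2) (Num.max A3 1).
have A_ge1 : 1 <= A by rewrite !le_max lexx !orbT.
have A_pos s : a1 + beta - alpha <= s -> forall k,
    \sum_(0 <= i < k) dpow i s <= A * dpow k s.
  move=> /HA1 h k; apply: (le_trans (h k)).
  by rewrite ler_wpM2r ?dpow_ge0// !le_max lexx.
have A_neg k : \sum_(0 <= i < k) dpow i (a1 - alpha) <= A.
  by apply: (le_trans (HA2 k)); rewrite !le_max lexx !orbT.
have A_q k : \sum_(0 <= i < k) dpow i (a2 - mu - beta) <= A * dpow k (a2 - mu - beta).
  apply: (le_trans (HA3 _ (lexx _) k)).
  by rewrite ler_wpM2r ?dpow_ge0// !le_max lexx !orbT.
(* the equation c = a + mu allows c = mu at level a = 0, and c = a2 at level a2 - mu *)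
have {}hd2Phi c a : c = a + mu -> 0 <= a -> a <= a2 - mu ->
    forall u v w : E c, V (emb E mu c u) ->
    space_norm a (d2Phi (emb E mu c u) (emb E mu c v) (emb E mu c w))
    <= C1' * (`|v| * `|emb E a0 c w| + `|emb E a0 c v| * `|w|
             + `|u| * `|emb E a0 c v| * `|emb E a0 c w|).
  move=> -> a_ge0 aa2 u v w Vu; apply: (le_trans (hd2Phi a a_ge0 aa2 u v w Vu)).
  by rewrite ler_wpM2r// !addr_ge0 ?mulr_ge0.
have {}hC2 c a : c = a + mu -> 0 <= a -> a <= a2 - mu ->
    C2_level V Phi dPhi d2Phi c a.
  by move=> ->; exact: hC2.
have {}hPsi_bound (v : E mu) (g : F 0) :
    V v -> in_infty (emb E 0 mu v) ->
    space_norm a1 (emb E 0 mu v) <= delta1 -> in_infty g ->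
    forall a : R, a1 <= a -> a <= a2 ->
    `|emb E a a2 (Psi v g)|
    <= C2' * (space_norm (a + beta - alpha) g
             + `|g| * space_norm (a + beta) (emb E 0 mu v)).
  move=> Vv vi vd gi a a1a aa2; apply: (le_trans (hPsi_bound v g Vv vi vd gi a a1a aa2)).
  by rewrite ler_wpM2r// addr_ge0 ?mulr_ge0 ?space_norm_ge0.
pose B := (1 + D) * A.
have B0 : 0 <= B by rewrite mulr_ge0 ?addr_ge0 ?(le_trans ler01 D1) ?(le_trans ler01 A_ge1).
pose D2 := 2 `^ beta * (D * (A + 1)).
have D20 : 0 <= D2.
  by rewrite !mulr_ge0 ?powR_ge0 ?addr_ge0 ?(le_trans ler01 D1) ?(le_trans ler01 A_ge1).
(* kappa will be K * eps; the hypothesis on kappa then asks that eta <= eps, as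
   4 = 2 * 2 with eps + eta <= 2 * eps *)
pose K := 4 * C2' * D2.
have K0 : 0 <= K := mulr_ge0 (mulr_ge0 (ler0n R 4) C2'0) D20.
have [e0 e00 He0] := small_exists (mulr_ge0 K0 B0) (mulr_ge0 (ler0n R 6) C1'0) r0 hdelta1.
pose N := Num.max c2 (a2 + beta).
have [Cg Cg0 HCg] := weak_smoothing_bounds hSF htheta two1 hc1 hc1b hc2
   (ltac:(by rewrite le_max lexx) : c2 <= N).
have a1alpha : a1 < alpha by lra.
have alphaa2 : alpha < a2 by lra.
have a10 : 0 <= a1 by lra.
have [CE CE0 HCE] := weak_change hSE (@dyadic_admissible R) htheta a10 a1alpha alphaa2
  hb1 hb1a hb2.
have core (g : F 0) (x : nat -> F c2) (M : R) : 0 < M -> M <= e0 / Cg ->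
    weak_decomp theta c1 beta g x M ->
    exists u : E mu, [/\ V u, Phi u = Phi 0 + g & exists x' : nat -> E b2,
      weak_decomp theta b1 alpha (emb E 0 mu u) x' (CE * (K * Cg) * M)].
  move=> M0 Me0 gx; have [_ gl gd] := HCg _ _ _ gx.
  have eps0 : 0 < Cg * M by rewrite mulr_gt0.
  have epse0 : Cg * M <= e0 by rewrite mulrC -ler_pdivlMr.
  have [k1 k2 k3 k4] := He0 _ eps0 epse0.
  have KBE : K * B * (Cg * M) = K * (Cg * M) * B by ring.
  rewrite KBE in k1 k2 k3 k4.
  have bN b : 0 <= b <= a2 + beta -> 0 <= b <= N.
    by move=> /andP[-> h]; rewrite le_max h orbT.
  have g_low b : 0 <= b <= a2 + beta -> space_norm b (SF (dyadic 0) g) <= Cg * M.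
    by move=> /bN /gl; rewrite /dyadic expr0.
  have g_diff b k : 0 <= b <= a2 + beta ->
      space_norm b (SF (dyadic k.+1) g - SF (dyadic k) g) <= Cg * M * dpow k (b - beta).
    move=> /bN /(gd b (dyadic k) (dyadic k.+1)) h.
    have h1 : dyadic k <= dyadic k.+1 :> R by rewrite -subr_ge0 dyadic_gap ltW// dyadic_gt0.
    have h2 : dyadic k.+1 <= 2 * dyadic k :> R by rewrite /dyadic exprS.
    have := h (dyadic_ge1 k) h1 h2.
    by rewrite dyadic_gap -/(dpow k _) dyadic_dpow.
  have g_lim : (fun k => SF (dyadic k) g) @ \oo --> g.
    have b2' : 0 < beta / 2 by lra.
    apply: (smoothing_approx hSF (@dyadic_admissible R) b2').
    by apply: (weak_in_space gx); lra.
  have fixK : 2 * C2' * D2 * (Cg * M + 6 * C1' * (K * (Cg * M) * B) ^+ 2) <= K * (Cg * M).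
    have KE : K * (Cg * M) = 2 * C2' * D2 * (Cg * M + Cg * M) by rewrite /K; ring.
    rewrite [leRHS]KE; apply: ler_wpM2l; last by rewrite lerD2l.
    exact: mulr_ge0 (mulr_ge0 (ler0n R 2) C2'0) D20.
  have kap0 : 0 <= K * (Cg * M) by rewrite mulr_ge0// ltW.
  have [u [Vu Phiu [y uy]]] := newton_solution hSE hSF ha0 ha0mu hmua1 beta_gt0
    halpha1 halpha2 ha2 h2alpha ball_V C1'0 C2'0 D1 A_ge1 hC2 hd2Phi hPsi_inv
    hPsi_bound SE_le SF_le A_pos A_neg A_q eps0 kap0 g_low g_diff g_lim k1 k2 k3 fixK.
  exists u; split => //; have [x' ux'] := HCE _ _ _ uy.
  by exists x'; rewrite (_ : _ * M = CE * (K * (Cg * M)))//; ring.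
exists (e0 / Cg / 2); split; first by rewrite !divr_gt0.
exists (CE * (K * Cg) * 2) => g [x0 [M0 gx0]] gsmall.
have C0 : 0 <= CE * (K * Cg) := mulr_ge0 (ltW CE0) (mulr_ge0 K0 (ltW Cg0)).
set wn := weak_norm theta c1 c2 beta g in gsmall *.
pose SM := [set M : R | exists x : nat -> F c2, weak_decomp theta c1 beta g x M].
have infSM : has_inf SM.
  split; first by exists M0, x0.
  by exists 0 => M' [x' /(weak_decomp_ge0 htheta)].
have wn0 : 0 <= wn.
  apply: lb_le_inf; first by exists M0, x0.
  by move=> M' [x' /(weak_decomp_ge0 htheta)].
(* a decomposition of g with constant at most twice the infimum exists unless the
   infimum is 0, in which case g = 0 *)
have [wn_gt0|] := ltP 0 wn.
  have [M [x gx] MW] := inf_adherent wn_gt0 infSM.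
  rewrite -/wn in MW.
  have WM : wn <= M by exact: weak_norm_le gx.
  have [|u [Vu Phiu [x' ux']]] := core g x M (lt_le_trans wn_gt0 WM) _ gx.
    apply: (le_trans (ltW MW)).
    by rewrite [leRHS]splitr; apply: lerD.
  exists u; split => //; first by exists x', (CE * (K * Cg) * M).
  apply: (le_trans (weak_norm_le htheta ux')).
  rewrite -[leRHS]mulrA; apply: ler_wpM2l => //; apply: (le_trans (ltW MW)).
  by rewrite mulrDl mul1r.
move=> wn_le0.
have g0 : g = 0.
  apply/normr0_eq0/le_anti; rewrite normr_ge0 andbT.
  apply/ler_addgt0Pr => e e_gt0; rewrite add0r.
  have [M [x gx] MW] := inf_adherent (divr_gt0 e_gt0 Cg0) infSM.
  have [gM _ _] := HCg _ _ _ gx.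
  apply: (le_trans gM); rewrite mulrC -ler_pdivlMr//; apply: (le_trans (ltW MW)).
  by rewrite gerDr.
exists 0; have ux := weak_decomp_zero E theta b1 b2 alpha.
rewrite linear0; split => //.
- by exists (fun=> 0), 0.
- by apply: (le_trans (weak_norm_le htheta ux)); rewrite mulr_ge0// mulr_ge0.
- by rewrite g0 addr0.
Qed.
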